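(* Let $p = p(n)$ and $d = (n-1)p$, and let $G \sim \mathcal{G}(n,p)$. (1) If $x \in (0, 1/8]$ is fixed and $d = n^{x + O(1/\log n)}$, then there is a function $g(n) = O(1/\log n)$ such that with high probability $\beta_{\mathrm{ms}}(G) \leq n^{y_4 + g(n)}$, where $y_4 = y_4(x) \in (0,1)$ is the unique solution of $f_x(y) = 4$. (2) If $x \in (0, 1/2]$ is fixed and $d = n^{x + O(1/\log n)}$, then there is a function $h(n) = O(1/\log n)$ such that with high probability $\beta_{\mathrm{ms}}(G) \geq n^{y_1 + h(n)}$, where $y_1 = y_1(x) \in (0,1)$ is the unique solution of $f_x(y) = 1$. (3) If $x \in (1/2, 1)$ is fixed and $d = n^{x + O(1/\log n)}$, then with high probability $\beta_{\mathrm{ms}}(G) = \infty$.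
   Context: $\mathcal{G}(n,p)$ is the binomial random graph on vertex set $\{1,\dots,n\}$ in which each pair of vertices is an edge independently with probability $p$. An event holds with high probability (w.h.p.) if its probability tends to $1$ as $n\to\infty$. For a graph $G=(V,E)$, $d(u,v)$ denotes the graph distance (taken to be $\infty$ if $u,v$ lie in different components). A set $R \subseteq V$ is multiset resolving if for every pair of distinct vertices $v \neq w$, the multisets $\{d(v,r): r \in R\}$ and $\{d(w,r): r \in R\}$ are distinct (equivalently, the vectors $(|\{r\in R: d(v,r)=k\}|)_{k\ge 0}$ and $(|\{r\in R: d(w,r)=k\}|)_{k\ge0}$ differ). The multiset metric dimension $\beta_{\mathrm{ms}}(G)$ is the minimum size of a multiset resolving set, or $\infty$ if none exists. For $x\in(0,1]$, $f_{x}(y) := \sum_{i=0}^{\lfloor 1/x \rfloor}\max\{ix + y - 1, 0\}$ for $y\in[0,1]$; for $x\in(0,1/8]$ the equation $f_x(y)=4$ has a unique solution in $(0,1)$, and for $x\in(0,1/2]$ the equation $f_x(y)=1$ has a unique solution in $(0,1)$. The assumption $d = n^{x+O(1/\log n)}$ means $d = n^{x+\delta(n)}$ for some $\delta(n) = O(1/\log n)$ (equivalently $d=\Theta(n^x)$). *)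

(* Defs.v *)
From mathcomp Require Import all_boot all_order all_algebra.
From mathcomp Require Import all_classical all_reals all_analysis.

Set Implicit Arguments.
Unset Strict Implicit.
Unset Printing Implicit Defensive.

Import Order.TTheory GRing.Theory Num.Theory.
Import numFieldNormedType.Exports.

Local Open Scope ring_scope.

Section Graphs.
Variable T : finType.

(* A simple graph on T is identified with its edge set, a subset of [pairs]. *)
Definition pairs : {set {set T}} := [set e : {set T} | #|e| == 2].

Implicit Types (G : {set {set T}}) (u v : T) (S : {set T}).

Definition adj G : rel T := [rel u v | [set u; v] \in G].

Definition walk G u v (k : nat) : bool :=
  [exists t : k.-tuple T, path (adj G) u t && (last u t == v)].

(* [None] is the infinite distance. A shortest walk repeats no vertex, so its
   length is below #|T|; see [gdistP]. *)
Definition gdist G u v : option nat :=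
  if connect (adj G) u v then Some (find (walk G u v) (iota 0 #|T|)) else None.

Lemma walk_connect G u v k : walk G u v k -> connect (adj G) u v.
Proof. by move=> /existsP[t /andP[pt /eqP <-]]; apply/connectP; exists t. Qed.

Lemma connect_walk G u v :
  connect (adj G) u v -> exists2 k, (k < #|T|)%N & walk G u v k.
Proof.
move=> /connectP[p0 pp0 ->]; case/shortenP: pp0 => p pp up _.
exists (size p); last by apply/existsP; exists (in_tuple p); rewrite pp eqxx.
by have := max_card (mem (u :: p)); rewrite (card_uniqP up).
Qed.

Lemma gdistP G u v k :
  gdist G u v = Some k <->
  walk G u v k /\ (forall j, (j < k)%N -> ~~ walk G u v j).
Proof.
have first m : (m < #|T|)%N -> walk G u v m ->
    let f := find (walk G u v) (iota 0 #|T|) in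
    walk G u v f /\ (forall j, (j < f)%N -> ~~ walk G u v j).
  move=> mT wm /=.
  have hs : has (walk G u v) (iota 0 #|T|).
    by apply/hasP; exists m => //; rewrite mem_iota.
  have fT := hs; rewrite has_find size_iota in fT.
  split=> [|j jf]; first by have := nth_find 0%N hs; rewrite nth_iota.
  by have := before_find 0%N jf; rewrite nth_iota ?(ltn_trans jf)// => ->.
rewrite /gdist; split=> [|[wk mink]].
  case: ifP => // /connect_walk[m mT wm] [<-]; exact: first mT wm.
have cuv := walk_connect wk; rewrite cuv.
have [m mT wm] := connect_walk cuv.
move: (first m mT wm); cbv zeta; move: (find _ _) => f [wf minf].
by case: (ltngtP f k) => [/mink|/minf|->//]; rewrite ?wf ?wk.
Qed.

(* [perm_eq] is equality of the multisets listed by the two sequences. *)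
Definition multiset_resolving G S : bool :=
  [forall v, forall w, (v != w) ==>
    ~~ perm_eq [seq gdist G v r | r in S] [seq gdist G w r | r in S]].

Definition ms_dim (R : realType) G : \bar R :=
  \big[Order.min/+oo%E]_(S : {set T} | multiset_resolving G S) (#|S|%:R)%:E.

End Graphs.

Section RandomGraph.
Local Open Scope classical_set_scope.
Variable R : realType.

Definition gnp_weight n (p : R) (G : {set {set 'I_n}}) : R :=
  \prod_(e in pairs 'I_n) (if e \in G then p else 1 - p).

Definition gnp_prob n (p : R) (A : pred {set {set 'I_n}}) : R :=
  \sum_(G in powerset (pairs 'I_n) | A G) gnp_weight p G.

Lemma gnp_prob_total n (p : R) : gnp_prob p (@predT {set {set 'I_n}}) = 1.
Proof.
pose a (e : {set 'I_n}) := if e \in pairs 'I_n then p else 0.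
pose b (e : {set 'I_n}) := if e \in pairs 'I_n then 1 - p else 1.
have -> : 1 = \prod_e (a e + b e) :> R.
  by rewrite big1// => e _; rewrite /a /b; case: ifP; rewrite ?add0r// addrC subrK.
rewrite bigA_distr (bigID (fun G => G \in powerset (pairs 'I_n))) /=.
rewrite [X in _ + X]big1 ?addr0; last first.
  move=> G; rewrite powersetE => /subsetPn[e eG eP].
  by rewrite (bigD1 e)//= eG /a (negbTE eP) mul0r.
apply: eq_big => G; rewrite ?andbT// powersetE => /fintype.subsetP GP.
rewrite /gnp_weight big_mkcond; apply: eq_bigr => e _.
rewrite /a /b; case: ifPn => [eP|eP]; first by [].
by rewrite (negbTE (contra (GP e) eP)).
Qed.

Definition whp (p : nat -> R) (A : forall n, pred {set {set 'I_n}}) : Prop :=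
  gnp_prob (p n) (A n) @[n --> \oo] --> (1 : R).

Definition O_inv_log (g : nat -> R) : Prop :=
  g =O_\oo (fun n => (ln n%:R)^-1).

(* d = (n - 1) p satisfies d = n ^ (x + O(1 / log n)); asymptotic in n, since
   at n = 1 the left-hand side is 0 and the right-hand side is 1. *)
Definition degree_exponent (p : nat -> R) (x : R) : Prop :=
  exists2 delta : nat -> R, O_inv_log delta &
    \forall n \near \oo, (n%:R - 1) * p n = n%:R `^ (x + delta n).

Definition fsum (x y : R) : R :=
  \sum_(i < (Num.truncn (1 / x)).+1) Num.max (i%:R * x + y - 1) 0.

Definition unique_solution (x c y : R) : Prop :=
  unique (fun z => 0 < z < 1 /\ fsum x z = c) y.

End RandomGraph.

(* Main.v *)
Require Import Defs.
From mathcomp Require Import all_boot all_order all_algebra.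
From mathcomp Require Import all_classical all_reals all_analysis.
From mathcomp Require Import finset ring lra zify.

(* Let k be the integer part of 1/x. Union bounds over vertex sets show that
   w.h.p. G expands by a factor of order n p: any set S with |S| <= C/p has at
   least c n p |S| neighbours that are not neighbours of a given W, as long as W
   is disjoint from S, |W| <= C'|S| and |W| <= C/p. With the bound 4 n p on the
   degrees this makes every ball of radius i <= k have size of order at most
   d^i, and makes at least a constant times d^i vertices lie at distance exactly
   i from v but more than i from w, for all v <> w. The edges at v are
   independent of G - v, whence the diameter is at most k + 1.
   Upper bound: a random set Q of size of order n^y contains about n^(ix+y-1) of
   the vertices at distance i from v and further from w. For R a uniform subset
   of Q, the i-th coordinates of v and w agree with probability at most the
   inverse square root of this number, even conditionally on the smaller
   indices; the product of these bounds is n^(-f(y)/2) = n^(-2).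
   Lower bound: by averaging, for at least half of the vertices v the number of
   points of R at distance i from v is O(n^(ix+y-1)) for every i <= k, and these
   k + 1 numbers determine the multiset of v; so there are too few multisets.
   In diameter 2, the multiset of a vertex of R is determined by its degree in
   the graph induced on R, and two vertices of that graph have equal degrees. *)

Set Implicit Arguments.
Unset Strict Implicit.
Unset Printing Implicit Defensive.

Import Order.TTheory GRing.Theory Num.Theory.
Import numFieldNormedType.Exports.

Local Open Scope ring_scope.

(** * Product Bernoulli measures *)

(** Obtained by squaring e^(-1/2) >= 1/2. The crude value 4 is enough both for [chernoff_upper] and
    for bounding (1 + 1/n)^n. *)
Lemma expR1_le4 (R : realType) : expR (1 : R) <= 4.
Proof.
have h : expR (- (1 / 2) : R) >= 2^-1 by apply: le_trans (expR_ge1Dx _); lra.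
rewrite [X in expR X](_ : 1 = - (- (1 / 2) + - (1 / 2))); last by lra.
rewrite expRN expRD -[leRHS]invrK lef_pV2 ?posrE ?mulr_gt0 ?expR_gt0 //.
by apply: (@le_trans _ _ (2^-1 * 2^-1)); [lra | apply: ler_pM].
Qed.

Section Bernoulli.
Variables (R : realType) (E : finType).
Implicit Types (p : E -> R) (G H D : {set E}) (X Y : {set E} -> R).

(** The parameter varies with the element so that one measure covers both G(n, p), where sets that
    are not pairs get parameter 0, and random vertex sets with a constant parameter. *)
Definition bern_weight p G : R := \prod_e (if e \in G then p e else 1 - p e).

Definition bern_exp p X : R := \sum_G bern_weight p G * X G.

Definition bern_prob p (A : pred {set E}) : R := bern_exp p (fun G => (A G)%:R).

(** The discrete form of measurability with respect to the coordinates in [D]. *)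
Definition local_on (U : Type) D (X : {set E} -> U) :=
  forall G H, G :&: D = H :&: D -> X G = X H.

Lemma eq_bern_exp p X Y : X =1 Y -> bern_exp p X = bern_exp p Y.
Proof. by move=> XY; rewrite /bern_exp; apply: eq_bigr => G _; rewrite XY. Qed.

Lemma bern_exp_prod p (f : E -> bool -> R) :
  bern_exp p (fun G => \prod_e f e (e \in G)) =
  \prod_e (p e * f e true + (1 - p e) * f e false).
Proof.
rewrite bigA_distr /bern_exp; apply: eq_bigr => G _.
rewrite /bern_weight -big_split /=.
by apply: eq_bigr => e _; case: (e \in G).
Qed.

Lemma bern_exp1 p : bern_exp p (fun=> 1) = 1.
Proof.
have := bern_exp_prod p (fun _ _ => 1).
rewrite [RHS]big1 => [h|e _]; last by rewrite !mulr1 addrC subrK.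
by rewrite -[RHS]h; apply: eq_bern_exp => G; rewrite big1.
Qed.

Lemma bern_expZ p a X : bern_exp p (fun G => a * X G) = a * bern_exp p X.
Proof. by rewrite /bern_exp big_distrr; apply: eq_bigr => G _ /=; rewrite mulrCA. Qed.

Lemma bern_expB p X Y :
  bern_exp p (fun G => X G - Y G) = bern_exp p X - bern_exp p Y.
Proof. by rewrite /bern_exp -sumrB; apply: eq_bigr => G _; rewrite mulrBr. Qed.

Lemma bern_exp_sum p (I : finType) (P : pred I) (F : I -> {set E} -> R) :
  bern_exp p (fun G => \sum_(i | P i) F i G) = \sum_(i | P i) bern_exp p (F i).
Proof.
rewrite /bern_exp exchange_big; apply: eq_bigr => G _ /=.
by rewrite big_distrr.
Qed.

(* For independent copies [G], [H], exchanging their traces outside [D] preserves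
   the joint law. *)
Lemma bern_exp_indep p D X Y : local_on D X -> local_on (~: D) Y ->
  bern_exp p (fun G => X G * Y G) = bern_exp p X * bern_exp p Y.
Proof.
move=> XD YD.
pose mix G H := (G :&: D) :|: (H :&: ~: D).
pose sw (c : {set E} * {set E}) := (mix c.1 c.2, mix c.2 c.1).
have mixX G H : X (mix G H) = X G.
  apply: XD; apply/setP => e; rewrite !inE.
  by case: (e \in D); rewrite ?andbF ?andbT ?orbF.
have mixY G H : Y (mix G H) = Y H.
  apply: YD; apply/setP => e; rewrite !inE.
  by case: (e \in D); rewrite ?andbF ?andbT ?orbF.
have swK : involutive sw.
  move=> [G H]; congr (_, _); apply/setP => e; rewrite !inE;
  by case: (e \in D); rewrite ?andbF ?andbT ?orbF ?orFb.
have w_sw c : bern_weight p (sw c).1 * bern_weight p (sw c).2 =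
              bern_weight p c.1 * bern_weight p c.2.
  rewrite /bern_weight -!big_split /=; apply: eq_bigr => e _; rewrite !inE.
  by case: (e \in D); rewrite ?andbF ?andbT ?orbF ?orFb // mulrC.
rewrite /bern_exp [RHS]big_distrlr /= pair_big /= (reindex_inj (inv_inj swK)) /=.
transitivity (\sum_G \sum_H bern_weight p G * bern_weight p H * (X G * Y G)).
  apply: eq_bigr => G _; rewrite -mulr_suml -mulr_sumr.
  have := bern_exp1 p; rewrite /bern_exp; under eq_bigr do rewrite mulr1.
  by move=> ->; rewrite mulr1.
rewrite pair_big /=; apply: eq_bigr => -[G H] _ /=.
rewrite mixX mixY [RHS]mulrACA; congr (_ * _).
exact: (esym (w_sw (G, H))).
Qed.

Lemma local_onS (U : Type) D D' (X : {set E} -> U) :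
  D \subset D' -> local_on D X -> local_on D' X.
Proof.
move=> DD XD G H GH; apply: XD.
by rewrite -(setIidPr DD) !setIA GH.
Qed.

Lemma local_on_comp (U U' : Type) D (f : U -> U') (X : {set E} -> U) :
  local_on D X -> local_on D (fun G => f (X G)).
Proof. by move=> XD G H /XD ->. Qed.

(** Factors are split off one at a time: by disjointness, the remaining ones live on the complement
    of [D a]. *)
Lemma bern_exp_prod_indep p (I : eqType) (r : seq I) (D : I -> {set E})
    (X : I -> {set E} -> R) : uniq r ->
  {in r &, forall i j, i != j -> [disjoint D i & D j]} ->
  (forall i, local_on (D i) (X i)) ->
  bern_exp p (fun G => \prod_(i <- r) X i G) = \prod_(i <- r) bern_exp p (X i).
Proof.
move=> + + XD; elim: r => [|a r IH] /=.
  rewrite big_nil => _ _; rewrite -[RHS](bern_exp1 p).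
  by apply: eq_bern_exp => G; rewrite big_nil.
move=> /andP[ar ur] dis.
rewrite big_cons -IH//; last first.
  by move=> i j ir jr; apply: dis; rewrite inE ?ir ?jr orbT.
rewrite -(@bern_exp_indep p (D a)) //.
  by apply: eq_bern_exp => G; rewrite big_cons.
move=> G H GH; apply: eq_big_seq => i ir.
apply: XD; have ai : a != i by apply: contraNneq ar => ->.
have ds : [disjoint D a & D i] by apply: dis => //; rewrite inE ?eqxx ?ir ?orbT.
have sub : D i \subset ~: D a by rewrite finset.subsetC -disjoints_subset.
by rewrite -(setIidPr sub) !setIA GH.
Qed.

Variable p : E -> R.
Hypothesis p01 : forall e, 0 <= p e <= 1.

Lemma bern_weight_ge0 G : 0 <= bern_weight p G.
Proof.
by apply: prodr_ge0 => e _; have /andP[? ?] := p01 e; case: ifP => _; lra.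
Qed.

Lemma ler_bern_exp X Y : (forall G, X G <= Y G) -> bern_exp p X <= bern_exp p Y.
Proof. by move=> XY; rewrite /bern_exp; apply: ler_sum => G _; rewrite ler_wpM2l ?bern_weight_ge0. Qed.

Lemma ler_bern_prob (A B : pred {set E}) :
  (forall G, A G -> B G) -> bern_prob p A <= bern_prob p B.
Proof.
move=> AB; apply: ler_bern_exp => G; rewrite ler_nat.
by case: (A G) (AB G) => // ->.
Qed.

Lemma bern_prob_ge0 (A : pred {set E}) : 0 <= bern_prob p A.
Proof. by apply: sumr_ge0 => G _; rewrite mulr_ge0 ?bern_weight_ge0. Qed.

Lemma bern_probC (A : pred {set E}) : bern_prob p A = 1 - bern_prob p (predC A).
Proof.
rewrite -(bern_exp1 p) -bern_expB; apply: eq_bern_exp => G /=.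
by case: (A G); rewrite /= ?subr0 ?subrr.
Qed.

Lemma bern_prob_le1 (A : pred {set E}) : bern_prob p A <= 1.
Proof. by rewrite bern_probC gerBl bern_prob_ge0. Qed.

Lemma bern_prob_exists (I : finType) (P : pred I) (A : I -> pred {set E}) :
  bern_prob p (fun G => [exists i, P i && A i G])
    <= \sum_(i | P i) bern_prob p (A i).
Proof.
rewrite -bern_exp_sum; apply: ler_bern_exp => G.
have [/existsP[i /andP[Pi Ai]]|_] := boolP [exists i, P i && A i G]; last first.
  by apply: sumr_ge0.
by rewrite (bigD1 i) //= Ai lerDl sumr_ge0.
Qed.

Lemma bern_probU (A B : pred {set E}) :
  bern_prob p (fun G => A G || B G) <= bern_prob p A + bern_prob p B.
Proof.
have -> : bern_prob p A + bern_prob p B =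
    bern_exp p (fun G => (A G)%:R + (B G)%:R).
  by rewrite /bern_prob /bern_exp -big_split /=; apply: eq_bigr => G _; rewrite mulrDr.
by apply: ler_bern_exp => G; case: (A G); case: (B G); rewrite /= ?addr0 ?add0r// lerDl.
Qed.

Section Chernoff.
Variables (I : finType) (Z : {set I}) (D : I -> {set E}) (A : I -> pred {set E}).
Hypothesis disD : {in Z &, forall i j, i != j -> [disjoint D i & D j]}.
Hypothesis locA : forall i, local_on (D i) (A i).
Variable q : R.

(** The exponential is a product of independent factors, each equal to [expR t] or 1 according to
    whether [A i] holds. *)
Lemma chernoff_mgf (t : R) :
  bern_exp p (fun G => expR (t * #|[set i in Z | A i G]|%:R)) =
  \prod_(i in Z) (1 + (expR t - 1) * bern_prob p (A i)).
Proof.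
pose X i G := if A i G then expR t else 1.
transitivity (bern_exp p (fun G => \prod_(i <- enum Z) X i G)).
  apply: eq_bern_exp => G; rewrite big_enum /= /X -big_mkcondr /=.
  rewrite prodr_const -expRM_natr; congr expR; congr (_ * _%:R).
  by rewrite cardsE; apply: eq_card => i.
rewrite (@bern_exp_prod_indep p I (enum Z) D X) ?enum_uniq //.
- rewrite big_enum /=; apply: eq_bigr => i _.
  rewrite /bern_prob -bern_expZ -{1}(bern_exp1 p).
  rewrite -[LHS]subr0 -[in LHS](subrr (bern_exp p (fun=> 1))) opprB addrA addrAC addrC.
  rewrite -[in LHS]bern_expB; congr (_ + _); apply: eq_bern_exp => G; rewrite /X.
  by case: (A i G); rewrite /= ?mulr1 ?mulr0 ?subrr.
- by move=> i j; rewrite !mem_enum; exact: disD.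
- by move=> i; apply: (local_on_comp (fun b : bool => if b then _ else _)).
Qed.

(** Exponential Markov inequality at t = -1. As e^(-1) <= 1/2, each factor of the generating
    function is at most 1 - q/2 <= e^(-q/2). With m the threshold, their product is e^(-2m), and the
    Markov factor e^m leaves e^(-m). *)
Lemma chernoff_lower : (forall i, i \in Z -> q <= bern_prob p (A i)) ->
  bern_prob p (fun G => #|[set i in Z | A i G]|%:R <= #|Z|%:R * q / 4)
    <= expR (- (#|Z|%:R * q / 4)).
Proof.
move=> qA; set m := #|Z|%:R * q / 4.
apply: (@le_trans _ _ (expR m *
    bern_exp p (fun G => expR (-1 * #|[set i in Z | A i G]|%:R)))).
  rewrite -bern_expZ; apply: ler_bern_exp => G; rewrite -expRD.
  case: (leP _ m) => h /=; last exact: expR_ge0.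
  by apply: le_trans (expR_ge1Dx _); lra.
rewrite chernoff_mgf.
apply: (@le_trans _ _ (expR m * \prod_(i in Z) expR (- (q / 2)))).
  rewrite ler_wpM2l ?expR_ge0 //; apply: ler_prod => i iZ.
  have e1 : expR (-1 : R) <= 2^-1.
    by rewrite expRN lef_pV2 ?posrE ?expR_gt0 // (le_trans _ (expR_ge1Dx _)).
  have e0 := expR_ge0 (-1 : R).
  have := qA i iZ; have := bern_prob_le1 (A i); have := bern_prob_ge0 (A i).
  set b := bern_prob _ _ => b0 b1 qb; apply/andP; split; first nra.
  by apply: le_trans (expR_ge1Dx _); nra.
rewrite prodr_const -expRM_natr -expRD ler_expR /m; lra.
Qed.

(** Exponential Markov inequality at t = 1. As e <= 4, each factor is at most 1 + 3q <= e^(3q); with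
    m = |Z| q, the Markov factor e^(-4m) turns the product e^(3m) into e^(-m). *)
Lemma chernoff_upper : (forall i, i \in Z -> bern_prob p (A i) <= q) -> 
  bern_prob p (fun G => 4 * (#|Z|%:R * q) <= #|[set i in Z | A i G]|%:R)
    <= expR (- (#|Z|%:R * q)).
Proof.
move=> qA; set m := #|Z|%:R * q.
apply: (@le_trans _ _ (expR (- (4 * m)) *
    bern_exp p (fun G => expR (1 * #|[set i in Z | A i G]|%:R)))).
  rewrite -bern_expZ; apply: ler_bern_exp => G; rewrite -expRD.
  case: (leP (4 * m) _) => h /=; last exact: expR_ge0.
  by apply: le_trans (expR_ge1Dx _); lra.
rewrite chernoff_mgf.
apply: (@le_trans _ _ (expR (- (4 * m)) * \prod_(i in Z) expR (3 * q))).
  rewrite ler_wpM2l ?expR_ge0 //; apply: ler_prod => i iZ.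
  have e1 := expR1_le4 R.
  have e0 : 2 <= expR (1 : R) by apply: le_trans (expR_ge1Dx _).
  have := qA i iZ; have := bern_prob_ge0 (A i).
  set b := bern_prob _ _ => b0 qb; apply/andP; split; first nra.
  by apply: le_trans (expR_ge1Dx _); nra.
rewrite prodr_const -expRM_natr -expRD ler_expR /m; lra.
Qed.

End Chernoff.
End Bernoulli.

(** * Balls and expansion *)

Section Balls.
Variable T : finType.
Implicit Types (G H : {set {set T}}) (u v w z : T) (S W U : {set T}).

Definition touches G z S := [exists s in S, [set z; s] \in G].

(** Balls are grown layer by layer, the form in which expansion can be iterated; [ball_gdist]
    relates them to distances. *)
Fixpoint gball G u i : {set T} :=
  if i is j.+1 then gball G u j :|: [set z | touches G z (gball G u j)] else [set u].

Lemma touchesU G z S W : touches G z (S :|: W) = touches G z S || touches G z W.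
Proof.
apply/existsP/orP => [[s]|[]/existsP[s]/andP[sS e]].
- rewrite inE => /andP[/orP[sS|sS] e]; [left|right]; apply/existsP; exists s;
  by rewrite sS.
- by exists s; rewrite inE sS.
- by exists s; rewrite inE sS orbT.
Qed.

Lemma walk0 G u v : walk G u v 0 = (v == u).
Proof.
apply/existsP/eqP => [[t]|->]; last by exists [tuple]; rewrite /= eqxx.
by rewrite tuple0 /= => /eqP.
Qed.

Lemma walkS G u v k : walk G u v k.+1 = [exists w, walk G u w k && adj G w v].
Proof.
apply/existsP/existsP => [[t /andP[pt /eqP lt]]|[w /andP[/existsP[t /andP[pt /eqP lt]] e]]].
  case/lastP: (tval t) (size_tuple t) pt lt => [//|s y].
  rewrite size_rcons rcons_path last_rcons => /eqP sz /andP[ps e] <-.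
  exists (last u s); rewrite e andbT; apply/existsP; exists (@Tuple _ _ s sz).
  by rewrite /= ps eqxx.
have sz : size (rcons t v) == k.+1 by rewrite size_rcons size_tuple.
by exists (Tuple sz); rewrite /= rcons_path pt lt e last_rcons eqxx.
Qed.

Lemma adjC G u v : adj G u v = adj G v u.
Proof. by rewrite /adj /= setUC. Qed.

Lemma ballP G u i z : reflect (exists2 j, (j <= i)%N & walk G u z j) (z \in gball G u i).
Proof.
elim: i z => [|i IH] z /=.
  rewrite inE -(walk0 G u z); apply: (iffP idP) => [h|[j]]; first by exists 0%N.
  by rewrite leqn0 => /eqP ->.
rewrite !inE; apply: (iffP orP) => [[/IH[j ji wj]|]|[j]].
- by exists j => //; apply: leqW.
- move=> /existsP[w /andP[/IH[j ji wj] e]]; exists j.+1 => //; rewrite walkS.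
  by apply/existsP; exists w; rewrite wj adjC.
- rewrite leq_eqVlt => /orP[/eqP ->|]; last first.
    by rewrite ltnS => ji wj; left; apply/IH; exists j.
  rewrite walkS => /existsP[w /andP[wi e]]; right; apply/existsP; exists w.
  by rewrite -[_ \in G]/(adj G z w) adjC e andbT; apply/IH; exists i.
Qed.

Lemma ball_gdist G u i z :
  (z \in gball G u i) = if gdist G u z is Some j then (j <= i)%N else false.
Proof.
apply/ballP/idP => [[j ji wj]|].
  case E : (gdist G u z) => [k|].
    have [_ min] := (gdistP _ _ _ _).1 E; rewrite leqNgt; apply/negP => ik.
    by have := min j (leq_ltn_trans ji ik); rewrite wj.
  by move: E; rewrite /gdist (walk_connect wj).
case E : (gdist G u z) => [k|//] ki; exists k => //.
by have [] := (gdistP _ _ _ _).1 E.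
Qed.

Lemma gdist0 G u z : (gdist G u z == Some 0%N) = (z == u).
Proof.
rewrite -[z == u](in_set1 z u) -[[set u]]/(gball G u 0) ball_gdist.
by case: (gdist G u z) => [j|//]; rewrite leqn0.
Qed.

Lemma gdistS G u i z :
  (gdist G u z == Some i.+1) = (z \in gball G u i.+1) && (z \notin gball G u i).
Proof.
rewrite !ball_gdist; case: (gdist G u z) => [j|//].
by rewrite -ltnNge -eqn_leq.
Qed.

Lemma ball_self G u i : u \in gball G u i.
Proof. by elim: i => [|i IH] /=; rewrite ?inE ?eqxx // IH. Qed.

(** [v] itself is removed because [G] ranges over arbitrary families of sets and may contain the
    singleton [[set v; v]]. *)
Definition nbr G v : {set T} := [set z in ~: [set v] | touches G z [set v]].

(** The next ball is covered by the closed neighbourhoods of the vertices of the previous one, each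
    of size at most [1 + D]. *)
Lemma ball_ub G (R : realType) (D : R) u i :
  (forall v, #|nbr G v|%:R <= D) -> #|gball G u i|%:R <= (1 + D) ^+ i.
Proof.
move=> deg; have D0 : 0 <= D by apply: le_trans (deg u).
elim: i => [|i IH]; first by rewrite /= cards1 expr0.
have sub : gball G u i.+1 \subset \bigcup_(s in gball G u i) (s |: nbr G s).
  apply/fintype.subsetP => z /=; rewrite !inE => /orP[zb|/existsP[s /andP[sb e]]].
    by apply/bigcupP; exists z => //; rewrite !inE eqxx.
  apply/bigcupP; exists s => //; rewrite !inE; case: eqP => //= _.
  by apply/existsP; exists s; rewrite inE eqxx.
apply: (@le_trans _ _ (\sum_(s in gball G u i) (1 + D))).
  apply: (@le_trans _ _ (\sum_(s in gball G u i) #|s |: nbr G s|)%:R).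
    rewrite ler_nat; apply: leq_trans (subset_leq_card sub) _.
    apply: (big_rec2 (fun (A : {set T}) (m : nat) => (#|A| <= m)%N)) => [|s A m _ h].
      by rewrite cards0.
    by apply: leq_trans (leq_card_setU _ _) _; rewrite leq_add2l.
  rewrite natr_sum; apply: ler_sum => s _.
  apply: (@le_trans _ _ (1 + #|nbr G s|%:R)); last by rewrite lerD2l.
  by rewrite -[1 in leRHS]/(1%:R) -natrD ler_nat cardsU1 leq_add2r leq_b1.
rewrite sumr_const exprSr -[_ *+ _]mulr_natl ler_wpM2r //; lra.
Qed.

(** For distinct vertices [z] outside [S :|: W], the pairs joining [z] to [S :|: W] form disjoint
    sets, so the conditions on different [z] are independent. *)
Definition fresh G S W : {set T} :=
  [set z in ~: (S :|: W) | touches G z S && ~~ touches G z W].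

(* Allowing [C2] to exceed [C1] matters: the rate [c] obtained for expansion
   depends on [C1], and [C2] is then chosen depending on [c]. *)
Definition expanding (R : realType) (p c C1 : R) (C2 : nat) G : bool :=
  [forall S : {set T}, forall W : {set T},
    [&& S != finset.set0, [disjoint S & W], p * #|S|%:R <= C1, p * #|W|%:R <= C1
      & (#|W| <= C2 * #|S|)%N]
    ==> (c * #|S|%:R <= #|fresh G S W|%:R)].

(** Only the edges at [v] are removed: [v] stays as an isolated vertex, so that the vertex type is
    unchanged. *)
Definition delv G v := [set e in G | v \notin e].

Lemma touches_delv G v z S : touches (delv G v) z S -> touches G z S.
Proof.
move=> /existsP[s /andP[sS]]; rewrite inE => /andP[e _]; apply/existsP; exists s.
by rewrite sS.
Qed.

Lemma ball_delv_sub G v u i : gball (delv G v) u i \subset gball G u i.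
Proof.
elim: i => [|i IH] //=; apply/fintype.subsetP => z; rewrite !inE.
move=> /orP[/(fintype.subsetP IH) -> //|/touches_delv/existsP[s /andP[sb e]]].
by apply/orP; right; apply/existsP; exists s; rewrite e (fintype.subsetP IH).
Qed.

Lemma ball_delv_notin G u v i : u != v -> v \notin gball (delv G v) u i.
Proof.
move=> uv; elim: i => [|i IH] /=; rewrite !inE; first by rewrite eq_sym.
rewrite negb_or IH /=; apply/existsP => -[s /andP[_]].
by rewrite !inE eqxx andbF.
Qed.

Section Expanding.
Variables (R : realType) (p c C1 D : R) (C2 : nat) (G : {set {set T}}).
Hypothesis (p0 : 0 <= p) (c0 : 0 <= c).
Hypothesis exG : expanding p c C1 C2 G.
Hypothesis degG : forall v, #|nbr G v|%:R <= D.
Variable k : nat.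
Hypothesis pC1 : p * (1 + D) ^+ k <= C1.

Let D0 (u : T) : 0 <= D. Proof. exact: le_trans (degG u). Qed.

Lemma p_ball_le (A : {set T}) u i : (i <= k)%N -> A \subset gball G u i ->
  p * #|A|%:R <= C1.
Proof.
move=> ik Ab; apply: le_trans pC1; rewrite ler_wpM2l //.
apply: (@le_trans _ _ ((1 + D) ^+ i)).
  by apply: le_trans (ball_ub u i degG); rewrite ler_nat subset_leq_card.
by rewrite ler_weXn2l // lerDl; exact: D0 u.
Qed.

(** Expansion is applied to the ball [S] with [W = [set v]]. A fresh vertex differs from [v], and
    its edge to [S] avoids [v], hence survives the deletion. *)
Lemma ball_delv_lb u v i : (0 < C2)%N -> p <= C1 -> u != v -> (i <= k.+1)%N ->
  c ^+ i <= #|gball (delv G v) u i|%:R.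
Proof.
move=> C20 pC uv; elim: i => [|i IH] ik; first by rewrite expr0 cards1.
set S := gball (delv G v) u i; set W := [set v].
have vS : v \notin S by exact: ball_delv_notin.
have S0 : S != finset.set0 by apply/set0Pn; exists u; exact: ball_self.
have := forallP (forallP exG S) W; rewrite S0 /W cards1 mulr1 pC.
rewrite (@p_ball_le S u i) ?ball_delv_sub //.
rewrite disjoint_sym disjoints1 vS /= muln_gt0 C20 card_gt0 S0 /= => h.
rewrite exprS; apply: (@le_trans _ _ (c * #|S|%:R)).
  by rewrite ler_wpM2l // IH // ltnW.
apply: le_trans h _; rewrite ler_nat; apply: subset_leq_card.
apply/fintype.subsetP => z; rewrite !inE negb_or => /and3P[/andP[zS zv] zt _].
apply/orP; right; have /existsP[s /andP[sS e]] := zt.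
apply/existsP; exists s; rewrite sS /= inE e /= !inE negb_or eq_sym zv /=.
by apply: contraNneq vS => ->.
Qed.

(** Expansion is applied to the difference [S] of the two balls of radius [i], with [W] the ball
    around [w]. A fresh vertex lies in the next ball around [v] and, being neither in [W] nor
    adjacent to it, outside the next ball around [w]. The condition on [C2] and the induction
    hypothesis give [#|W| <= C2 * #|S|]. *)
Lemma ball_diff_lb v w i : v != w -> (i <= k.+1)%N ->
  (forall j, (j <= k)%N -> (1 + D) ^+ j <= C2%:R * c ^+ j) ->
  c ^+ i <= #|gball G v i :\: gball G w i|%:R.
Proof.
move=> vw + hC2; elim: i => [|i IH] ik.
  rewrite expr0 /= (_ : _ :\: _ = [set v]) ?cards1 //.
  by apply/setP => z; rewrite !inE; case: (z =P v) => [->|]; rewrite ?andbF // vw.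
have {}IH := IH (ltnW ik).
set S := gball G v i :\: gball G w i in IH *; set W := gball G w i.
(* Expansion says nothing about the empty set, but then the induction hypothesis makes [c ^+ i]
   nonpositive. *)
have [S0|S0] := eqVneq S finset.set0.
  move: IH; rewrite S0 cards0 => IH; rewrite exprS.
  by apply: (@le_trans _ _ (c * 0)); [rewrite ler_wpM2l | rewrite mulr0].
have := forallP (forallP exG S) W; rewrite S0.
rewrite (@p_ball_le S v i) ?subsetDl // (@p_ball_le W w i) //.
have -> : [disjoint S & W] by rewrite disjoint_sym disjoints_subset setCD subsetUr.
have -> : (#|W| <= C2 * #|S|)%N.
  rewrite -(ler_nat R) natrM; apply: le_trans (ball_ub w i degG) _.
  by apply: le_trans (hC2 i ik) _; rewrite ler_wpM2l.
rewrite /= => h.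
rewrite exprS; apply: (@le_trans _ _ (c * #|S|%:R)); first by rewrite ler_wpM2l.
apply: le_trans h _; rewrite ler_nat; apply: subset_leq_card.
apply/fintype.subsetP => z; rewrite !inE !negb_or => /and3P[/andP[zS zW] zt tW].
rewrite zW tW /=; apply/orP; right.
have /existsP[s /andP[sS e]] := zt; apply/existsP; exists s; rewrite e andbT.
by move: sS; rewrite inE => /andP[].
Qed.

End Expanding.
End Balls.

(** * Probability estimates in G(n, p) *)

Section ElementaryBounds.
Variable R : realType.

Lemma sum_expr_card (T : finType) (a : R) :
  \sum_(S : {set T}) a ^+ #|S| = (1 + a) ^+ #|T|.
Proof.
rewrite -prodr_const addrC bigA_distr; apply: eq_bigr => S _.
by rewrite -big_mkcond prodr_const.
Qed.

Lemma expr_le_expR (q : R) (m : nat) : 0 <= q <= 1 -> (1 - q) ^+ m <= expR (- (q * m%:R)).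
Proof.
move=> /andP[q0 q1]; rewrite -mulNr expRM_natr.
by rewrite lerXn2r ?nnegrE ?expR_ge0 ?subr_ge0 // expR_ge1Dx.
Qed.

(** For q <= 1/2 one has 1/(1 - q) <= 1 + 2q <= e^(2q). *)
Lemma expR_le_expr (q : R) (m : nat) : 0 <= q <= 1 / 2 ->
  expR (- (2 * q * m%:R)) <= (1 - q) ^+ m.
Proof.
move=> /andP[q0 q1]; rewrite -mulNr expRM_natr.
rewrite lerXn2r ?nnegrE ?expR_ge0 ?subr_ge0 //; first by lra.
rewrite expRN -[leLHS]mul1r ler_pdivrMr ?expR_gt0 //.
by have := expR_ge1Dx (2 * q); nra.
Qed.

End ElementaryBounds.

Section GnpBounds.
Variables (R : realType) (n : nat) (p : R).
Hypothesis p01 : 0 <= p <= 1.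
Local Notation V := 'I_n.
Implicit Types (G : {set {set V}}) (u v z : V) (S W U : {set V}).

Definition gnp_param (e : {set V}) : R := if e \in pairs V then p else 0.

Lemma gnp_param01 e : 0 <= gnp_param e <= 1.
Proof. by rewrite /gnp_param; case: ifP => // _; rewrite lexx ler01. Qed.

Lemma gnp_probE (A : pred {set {set V}}) : gnp_prob p A = bern_prob gnp_param A.
Proof.
rewrite /gnp_prob /bern_prob /bern_exp [RHS](bigID (fun G => G \in powerset (pairs V))).
rewrite /= [X in _ + X]big1 ?addr0; last first.
  move=> G; rewrite powersetE => /subsetPn[e eG eP].
  by rewrite /bern_weight (bigD1 e) //= eG /gnp_param (negbTE eP) !mul0r.
rewrite big_mkcondr; apply: eq_bigr => G; rewrite powersetE => /fintype.subsetP GP.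
rewrite -mulrb mulrC mulr_natl; congr (_ *+ _).
rewrite /gnp_weight /bern_weight big_mkcond; apply: eq_bigr => e _.
rewrite /gnp_param; case: ifPn => [//|eP].
by rewrite (negbTE (contra (GP e) eP)) subr0.
Qed.

Definition edge_set z U : {set {set V}} := [set [set z; s] | s in U].

Lemma mem_edge_set z s U : s \in U -> [set z; s] \in edge_set z U.
Proof. by move=> sU; apply/imsetP; exists s. Qed.

Lemma touches_local z U : local_on (edge_set z U) (fun G => touches G z U).
Proof.
move=> G H GH; apply: eq_existsb => s; apply: andb_id2l => sU.
have /setP/(_ [set z; s]) := GH; rewrite !inE.
by rewrite mem_edge_set // !andbT.
Qed.

Lemma edge_set_disjoint U z z' : z \notin U -> z' \notin U -> z != z' ->
  [disjoint edge_set z U & edge_set z' U].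
Proof.
move=> zU zU' zz'; rewrite -setI_eq0; apply/eqP/setP => e; rewrite !inE.
apply/negP => /andP[/imsetP[s sU ->] /imsetP[s' sU' E]].
have : z \in [set z'; s'] by rewrite -E !inE eqxx.
rewrite !inE (negbTE zz') /= => /eqP zs.
by rewrite zs sU' in zU.
Qed.

Lemma card_edge_set z U : z \notin U -> #|edge_set z U| = #|U|.
Proof.
move=> zU; apply: card_in_imset => s s' sU sU' E.
have : s \in [set z; s'] by rewrite -E !inE eqxx orbT.
by rewrite !inE => /orP[/eqP sz|/eqP //]; rewrite -sz sU in zU.
Qed.

Lemma prob_no_touch z U : z \notin U ->
  bern_prob gnp_param (fun G => ~~ touches G z U) = (1 - p) ^+ #|U|.
Proof.
move=> zU; pose f e b : R := if e \in edge_set z U then (~~ b)%:R else 1.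
transitivity (bern_exp gnp_param (fun G => \prod_e f e (e \in G))).
  apply: eq_bern_exp => G; rewrite /f -big_mkcond /=.
  have [/existsP[s /andP[sU sG]]|h] := boolP (touches G z U).
    by rewrite (bigD1 [set z; s]) ?mem_edge_set //= sG mul0r.
  rewrite big1 // => e /imsetP[s sU ->].
  have : [set z; s] \notin G by apply: contra h => h; apply/existsP; exists s; rewrite sU.
  by move=> ->.
rewrite bern_exp_prod -(card_edge_set zU) -prodr_const [RHS]big_mkcond.
apply: eq_bigr => e _; rewrite /f; case: ifP => [/imsetP[s sU ->]|_] /=.
  rewrite /gnp_param inE cards2; have -> : z != s by apply: contraNneq zU => ->.
  by rewrite eqxx mulr0 add0r mulr1.
by rewrite !mulr1 addrC subrK.
Qed.

Lemma prob_touch z U : z \notin U ->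
  bern_prob gnp_param (fun G => touches G z U) = 1 - (1 - p) ^+ #|U|.
Proof.
by move=> zU; rewrite bern_probC; congr (1 - _); rewrite -(prob_no_touch zU).
Qed.

(** Subtracting the event of no edge to [S :|: W] from that of no edge to [W] gives the probability
    (1-p)^|W| (1 - (1-p)^|S|). The first factor is at least e^(-2 C1); with x = p |S|, the second is
    at least 1 - e^(-x) >= x/(1+x) >= x/(1 + C1). *)
Lemma prob_fresh (C1 : R) z S W : p <= 1 / 2 -> [disjoint S & W] ->
  z \notin S :|: W -> p * #|S|%:R <= C1 -> p * #|W|%:R <= C1 ->
  expR (- (2 * C1)) / (1 + C1) * (p * #|S|%:R)
    <= bern_prob gnp_param (fun G => touches G z S && ~~ touches G z W).
Proof.
move=> p2 dSW zSW pS pW; have /andP[p0 p1] := p01.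
have zW : z \notin W by apply: contra zSW; rewrite inE orbC => ->.
have -> : bern_prob gnp_param (fun G => touches G z S && ~~ touches G z W) =
    (1 - p) ^+ #|W| * (1 - (1 - p) ^+ #|S|).
  rewrite mulrBr mulr1 -exprD addnC.
  have -> : (#|S| + #|W| = #|S :|: W|)%N by apply/esym/eqP; rewrite (leq_card_setU S W).2.
  rewrite -(prob_no_touch zW) -(prob_no_touch zSW) -bern_expB.
  apply: eq_bern_exp => G; rewrite touchesU.
  by case: (touches G z S); case: (touches G z W); rewrite /= ?subr0 ?subrr.
have s0 : 0 <= p * #|S|%:R by rewrite mulr_ge0.
have C0 : 0 <= C1 by apply: le_trans pS.
rewrite -mulrA; apply: ler_pM; rewrite ?expR_ge0 //.
- by rewrite mulr_ge0 // invr_ge0; lra.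
- apply: le_trans (expR_le_expr #|W| _); last by rewrite p0.
  by rewrite ler_expR -mulrA lerN2 ler_pM2l.
- apply: (@le_trans _ _ (1 - expR (- (p * #|S|%:R)))); last first.
    by rewrite lerD2l lerN2 expr_le_expR.
  rewrite expRN; set x := p * _ in s0 pS *.
  have e := expR_ge1Dx x.
  apply: (@le_trans _ _ (1 - (1 + x)^-1)); last first.
    by rewrite lerD2l lerN2 lef_pV2 ?posrE ?expR_gt0 //; lra.
  have -> : 1 - (1 + x)^-1 = (1 + x)^-1 * x by field; apply: lt0r_neq0; lra.
  by rewrite ler_wpM2r // lef_pV2 ?posrE; lra.
Qed.

(* [8 = 4 * 2]: the factor lost in [chernoff_lower] and the fact that at least
   half of the vertices lie outside [S :|: W]. *)
Definition growth (C1 : R) : R := expR (- (2 * C1)) / (8 * (1 + C1)) * (n%:R * p).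

(** Union bound over the admissible pairs: each fails with probability at most e^(-c|S|) by
    [chernoff_lower]. With rho = n^C2 e^(-c), which pays for the choice of [W], the sum of rho^|S|
    over nonempty [S] is (1 + rho)^n - 1. *)
Lemma prob_not_expanding (C1 : R) (C2 : nat) : p <= 1 / 2 -> (0 < n)%N ->
  4 * C1 <= n%:R * p -> 0 < p ->
  bern_prob gnp_param (fun G => ~~ expanding p (growth C1) C1 C2 G)
    <= 4 * (expR (n%:R * (n%:R ^+ C2 * expR (- growth C1))) - 1).
Proof.
move=> p2 n0 npC p0; set c := growth C1.
pose cond (SW : {set V} * {set V}) :=
  [&& SW.1 != finset.set0, [disjoint SW.1 & SW.2], p * #|SW.1|%:R <= C1,
      p * #|SW.2|%:R <= C1 & (#|SW.2| <= C2 * #|SW.1|)%N].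
pose few (SW : {set V} * {set V}) G := ~~ (c * #|SW.1|%:R <= #|fresh G SW.1 SW.2|%:R).
have n0' : 0 < n%:R :> R by rewrite ltr0n.
have step SW : cond SW -> bern_prob gnp_param (few SW) <= expR (- c) ^+ #|SW.1|.
  case: SW => S W /and5P[/= S0 dSW pS pW cW].
  set Z := ~: (S :|: W).
  have C10 : 0 <= C1 by apply: le_trans pS; rewrite mulr_ge0 // ltW.
  pose q := expR (- (2 * C1)) / (1 + C1) * (p * #|S|%:R).
  (* By [4 * C1 <= n%:R * p], the sets [S] and [W] together have at most 2 C1/p <= n/2 vertices. *)
  have Zc : #|Z|%:R >= n%:R / 2 :> R.
    have : (#|S :|: W| + #|Z| = n)%N by rewrite cardsC card_ord.
    have : (#|S :|: W| <= #|S| + #|W|)%N by rewrite (leq_card_setU S W).1.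
    rewrite -(ler_nat R) natrD => h1.
    move=> /(congr1 (fun m => m%:R : R)); rewrite natrD => h2.
    by rewrite -(ler_pM2l p0); nra.
  have cZ : c * #|S|%:R <= #|Z|%:R * q / 4.
    have -> : c * #|S|%:R = n%:R / 2 * q / 4.
      by rewrite /c /growth /q; field; rewrite !gt_eqF //; lra.
    rewrite ler_pM2r ?invr_gt0 // ler_wpM2r //.
    by rewrite /q !mulr_ge0 ?invr_ge0 ?expR_ge0 ?(ltW p0) //; lra.
  have := @chernoff_lower R _ gnp_param gnp_param01 V Z
    (fun z => if z \in Z then edge_set z (S :|: W) else [set: {set V}])
    (fun z G => touches G z S && ~~ touches G z W) _ _ q _.
  set ch := bern_prob _ _ => h.
  apply: (@le_trans _ _ ch).
    by apply: (ler_bern_prob gnp_param01) => G; rewrite /few -ltNge => /ltW/le_trans; exact.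
  apply: le_trans (h _ _ _) _.
  - move=> z z' zZ zZ'; rewrite zZ zZ'; apply: edge_set_disjoint; move: zZ zZ';
    by rewrite !inE.
  - move=> z; case: ifP => _; last by move=> G H; rewrite !setIT => ->.
    have loc U : U \subset S :|: W -> local_on (edge_set z (S :|: W)) (fun G => touches G z U).
      by move=> /imsetS h'; apply: local_onS (h' _ _) (@touches_local z U).
    by move=> G H GH; rewrite (loc S _ G H GH) ?subsetUl // (loc W _ G H GH) ?subsetUr.
  - by move=> z; rewrite inE => zSW; apply: prob_fresh.
  by rewrite -expRM_natr ler_expR mulNr lerN2.
apply: (@le_trans _ _ (\sum_(SW | cond SW) bern_prob gnp_param (few SW))).
  apply: le_trans (bern_prob_exists gnp_param01 _ _).
  apply: (ler_bern_prob gnp_param01) => G /forallPn[S /forallPn[W]].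
  rewrite negb_imply => /andP[h1 h2]; apply/existsP; exists (S, W).
  by rewrite /cond /few h1 h2.
set rho := n%:R ^+ C2 * expR (- c).
have rho0 : 0 <= rho by rewrite mulr_ge0 ?exprn_ge0 ?expR_ge0 ?ler0n.
(* The number of [W] of size at most [m] is at most [n ^ m \sum_W n ^- #|W|],
   and that sum is [(1 + 1 / n) ^ n], at most [e]. *)
apply: (@le_trans _ _ (\sum_(S : {set V} | S != finset.set0) \sum_(W : {set V})
    rho ^+ #|S| * n%:R^-1 ^+ #|W|)).
  rewrite [leRHS]pair_big /= [leLHS]big_mkcond [leRHS]big_mkcond; apply: ler_sum => -[S W] _ /=.
  case: ifP => [cSW|_]; last first.
    by case: ifP => // _; rewrite mulr_ge0 ?exprn_ge0 ?invr_ge0.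
  have /and5P[/= S0 _ _ _ cW] := cSW; rewrite S0 /=.
  apply: le_trans (step _ cSW) _; rewrite /= /rho exprMn mulrAC ler_peMl ?exprn_ge0 ?expR_ge0 //.
  rewrite -exprM exprVn ler_pdivlMr ?exprn_gt0 // mul1r.
  by rewrite ler_weXn2l // ler1n.
under eq_bigr do rewrite -mulr_sumr.
rewrite -mulr_suml sum_expr_card card_ord [leLHS]mulrC ler_pM //.
- by apply: sumr_ge0 => S _; rewrite exprn_ge0.
- apply: le_trans (expR1_le4 R); rewrite -[X in expR X](mulVf (lt0r_neq0 n0')) expRM_natr.
  by rewrite lerXn2r ?nnegrE ?expR_ge0 ?expR_ge1Dx // addr_ge0 // invr_ge0.
- have -> : \sum_(S : {set V} | S != finset.set0) rho ^+ #|S| = (1 + rho) ^+ n - 1.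
    rewrite -[in RHS](card_ord n) -sum_expr_card [in RHS](bigD1 finset.set0) //= cards0 expr0.
    by rewrite addrAC subrr add0r.
  rewrite lerD2r mulrC expRM_natr lerXn2r ?nnegrE ?expR_ge0 ?expR_ge1Dx //.
  by rewrite addr_ge0.
Qed.

Lemma prob_max_degree :
  bern_prob gnp_param (fun G => ~~ [forall v, #|nbr G v|%:R <= 4 * (n%:R * p)])
    <= n%:R * expR (- ((n%:R - 1) * p)).
Proof.
have /andP[p0 p1] := p01.
apply: (@le_trans _ _ (\sum_(v : V) expR (- ((n%:R - 1) * p)))); last first.
  by rewrite sumr_const card_ord mulr_natl.
apply: (@le_trans _ _ (\sum_(v : V) bern_prob gnp_param
    (fun G => ~~ (#|nbr G v|%:R <= 4 * (n%:R * p))))).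
  apply: le_trans (bern_prob_exists gnp_param01 xpredT _).
  by apply: (ler_bern_prob gnp_param01) => G /forallPn[v h]; apply/existsP; exists v.
apply: ler_sum => v _; set Z := ~: [set v].
have Zc : #|Z|%:R = n%:R - 1 :> R.
  have : (#|[set v]| + #|Z| = n)%N by rewrite cardsC card_ord.
  by rewrite cards1 => /(congr1 (fun m => m%:R : R)); rewrite natrD; lra.
have := @chernoff_upper R _ gnp_param gnp_param01 V Z
    (fun z => edge_set z [set v]) (fun z G => touches G z [set v]) _ _ p _.
set ch := bern_prob _ _ => h; apply: (@le_trans _ _ ch).
  apply: (ler_bern_prob gnp_param01) => G; rewrite -ltNge => /ltW; apply: le_trans.
  by rewrite Zc; nra.
rewrite -Zc; apply: h.
- move=> z z' zZ zZ'; apply: edge_set_disjoint; move: zZ zZ'; by rewrite !inE.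
- by move=> z; apply: touches_local.
- move=> z; rewrite inE => zv; rewrite prob_touch // cards1 expr1; lra.
Qed.

(* [gball (delv G v) u k] does not depend on the edges at [v]. *)
Lemma prob_far (k : nat) (a : R) u v : u != v ->
  bern_prob gnp_param (fun G => (a <= #|gball (delv G v) u k|%:R) &&
     ~~ touches G v (gball (delv G v) u k)) <= expR (- (p * a)).
Proof.
move=> uv; have /andP[p0 p1] := p01.
pose B G := gball (delv G v) u k.
pose D : {set {set V}} := [set e : {set V} | v \in e].
have locB A : local_on (~: D) (fun G => (B G == A)%:R : R).
  move=> G H GH; rewrite /B; suff -> : delv G v = delv H v by [].
  apply/setP => e; have /setP/(_ e) := GH; rewrite !inE.
  by case: (v \in e); rewrite ?andbF ?andbT.
have locT (A : {set V}) : local_on D (fun G => ((a <= #|A|%:R) && ~~ touches G v A)%:R : R).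
  have h := @touches_local v A.
  have /local_onS/(_ h) hD : edge_set v A \subset D.
    by apply/fintype.subsetP => e /imsetP[s _ ->]; rewrite !inE eqxx.
  by move=> G H /hD ->.
have -> : bern_prob gnp_param (fun G => (a <= #|B G|%:R) && ~~ touches G v (B G)) =
   \sum_(A : {set V}) bern_exp gnp_param (fun G =>
      ((a <= #|A|%:R) && ~~ touches G v A)%:R * (B G == A)%:R).
  rewrite -bern_exp_sum; apply: eq_bern_exp => G.
  rewrite (bigD1 (B G)) //= eqxx mulr1 big1 ?addr0 // => A /negbTE.
  by rewrite eq_sym => ->; rewrite mulr0.
apply: (@le_trans _ _ (\sum_(A : {set V}) expR (- (p * a)) *
    bern_prob gnp_param (fun G => B G == A))).
  apply: ler_sum => A _.
  rewrite (bern_exp_indep _ (locT A) (locB A)).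
  have b0 := bern_prob_ge0 gnp_param01 (fun G => B G == A).
  (* The ball in [delv G v] avoids [v], so a value containing [v] has probability 0. *)
  have [vA|vA] := boolP (v \in A).
    have -> : bern_exp gnp_param (fun G => (B G == A)%:R) = 0.
      rewrite /bern_exp big1 // => G _; case: eqP => [BA|]; last by rewrite mulr0.
      by have := ball_delv_notin G k uv; rewrite -[gball _ _ _]/(B G) BA vA.
    by rewrite mulr0 mulr_ge0 ?expR_ge0.
  rewrite ler_wpM2r //.
  have [aA|aA] := boolP (a <= #|A|%:R); last first.
    by rewrite /bern_exp big1 ?expR_ge0 // => G _; rewrite mulr0.
  rewrite [leLHS](_ : _ = (1 - p) ^+ #|A|); last by rewrite -(prob_no_touch vA).
  by apply: le_trans (expr_le_expR _ p01) _; rewrite ler_expR lerN2 ler_wpM2l.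
rewrite -mulr_sumr -bern_exp_sum -[leRHS]mulr1 ler_wpM2l ?expR_ge0 //.
rewrite -[leRHS](bern_exp1 gnp_param); apply: (ler_bern_exp gnp_param01) => G.
rewrite (bigD1 (B G)) //= eqxx big1 ?addr0 // => A /negbTE.
by rewrite eq_sym => ->.
Qed.

End GnpBounds.

(** * Existence of small resolving sets *)

Section CentralBinomial.
Local Open Scope nat_scope.

Lemma bin_le_half n m : 'C(n, m) <= 'C(n, n./2).
Proof.
have mono a b : a <= b -> b <= n./2 -> 'C(n, a) <= 'C(n, b).
  elim: b => [|b IH]; first by rewrite leqn0 => /eqP ->.
  rewrite leq_eqVlt => /orP[/eqP -> //|]; rewrite ltnS => ab bn.
  apply: leq_trans (IH ab (ltnW bn)) _.
  have := mul_bin_left n b; have : b.+1 <= n - b by lia.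
  by move=> h E; rewrite -(leq_pmul2l (ltn0Sn b)) E leq_mul2r h orbT.
have [mn|mn] := leqP m n./2; first exact: mono.
have [nm|nm] := ltnP n m; first by rewrite bin_small.
by rewrite -bin_sub //; apply: mono => //; lia.
Qed.

(** By the recurrence C(2m+2, m+1) (m+1) = 2 (2m+1) C(2m, m), the induction step reduces to
    (2m+1)(2m+3) <= 4 (m+1)^2. *)
Lemma central_bin_sqr m : 'C(m.*2, m) ^ 2 * m.*2.+1 <= 16 ^ m.
Proof.
elim: m => [|m IH] //.
have E : 'C(m.+1.*2, m.+1) * m.+1 = 'C(m.*2, m) * (2 * m.*2.+1).
  have h1 := mul_bin_diag m.*2.+1 m; have h2 := mul_bin_diag m.*2 m.
  have h3 := mul_bin_left m.*2 m; have h4 := binS m.*2.+1 m.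
  have h5 := binS m.*2 m.
  have h6 : 'C(m.*2.+1, m.+1) = 'C(m.*2.+1, m).
    by rewrite -bin_sub; [congr ('C(_, _)); lia | lia].
  by rewrite doubleS; nia.
have : ('C(m.+1.*2, m.+1) * m.+1) ^ 2 * m.+1.*2.+1 <= 16 ^ m.+1 * m.+1 ^ 2.
  rewrite E; move: IH; set c := 'C(_, _); rewrite [16 ^ m.+1]expnS; set t := 16 ^ m.
  move=> IH.
  have -> : (c * (2 * m.*2.+1)) ^ 2 * m.+1.*2.+1 =
     (c ^ 2 * m.*2.+1) * (4 * m.*2.+1 * m.+1.*2.+1) by ring.
  apply: (@leq_trans (t * (4 * m.*2.+1 * m.+1.*2.+1))); first by rewrite leq_mul2r IH orbT.
  have -> : 16 * t * m.+1 ^ 2 = t * (16 * m.+1 ^ 2) by ring.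
  by rewrite leq_mul2l; apply/orP; right; nia.
rewrite expnMn => h; rewrite -(@leq_pmul2r (m.+1 ^ 2)) ?expn_gt0 //.
by apply: leq_trans h; rewrite mulnAC.
Qed.

(** In probabilistic terms, a uniform subset of an n-set has any prescribed size with probability at
    most n^(-1/2). For odd n, the middle coefficient is half of the central one for n + 1. *)
Lemma bin_sqr_le n m : 'C(n, m) ^ 2 * n <= 4 ^ n.
Proof.
apply: (@leq_trans ('C(n, n./2) ^ 2 * n)).
  by rewrite leq_mul2r leq_exp2r // bin_le_half orbT.
have E16 a : 16 ^ a = 4 ^ a.*2 by rewrite -mul2n expnM.
have [no|ne] := boolP (odd n); last first.
  have En : n = n./2.*2 by rewrite even_halfK.
  have := central_bin_sqr n./2; rewrite E16 -En; apply: leq_trans.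
  by rewrite leq_mul2l leqnSn orbT.
set h := n./2; have En : n = h.*2.+1 by rewrite -[LHS]odd_double_half no.
have := central_bin_sqr h.+1; rewrite E16 doubleS.
have -> : 'C(h.*2.+2, h.+1) = 2 * 'C(n, h).
  rewrite binS -En mul2n -addnn; congr (_ + _).
  by rewrite -bin_sub; [congr ('C(_, _)); lia | lia].
rewrite En [4 ^ h.*2.+2]expnS; nia.
Qed.

End CentralBinomial.

Section TriangularCount.
Variables (R : realType) (T : finType).
Variables (X Y A : nat -> {set T}).
Hypothesis AX : forall i, A i \subset X i.
Hypothesis AY : forall i j, (j <= i)%N -> [disjoint A i & Y j].
Hypothesis AXlt : forall i j, (j < i)%N -> [disjoint A i & X j].

(** With [X i] and [Y i] the spheres of radius [i] about two vertices, these are the subsets of [Q]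
    that fail to separate the two vertices at the radii in [s]. *)
Definition balanced (s : seq nat) (U Q : {set T}) :=
  (U \subset Q) && all (fun i => #|U :&: X i| == #|U :&: Y i|) s.

(* The elements of [A i] only influence the coordinates from [i] on, so the
   largest index can be integrated out first. *)
Lemma balanced_count (s : seq nat) (Q : {set T}) (t : nat -> R) :
  pairwise (fun i j => (j < i)%N) s ->
  (forall i, i \in s -> 0 < t i <= #|A i :&: Q|%:R) ->
  #|[set U | balanced s U Q]|%:R <= 2 ^+ #|Q| * \prod_(i <- s) (Num.sqrt (t i))^-1.
Proof.
elim: s Q => [|i s IH] Q /=.
  move=> _ _; rewrite big_nil mulr1 -natrX -card_powerset ler_nat.
  apply: subset_leq_card; apply/fintype.subsetP => U; rewrite !inE /balanced /=.
  by rewrite andbT.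
move=> /andP[/allP si ps] tA.
set a := A i :&: Q; set Q' := Q :\: A i.
have /andP[ti0 tia] := tA i (mem_head _ _).
have dis j : j \in s -> A j :&: Q' = A j :&: Q.
  move=> js; apply/setP => z; rewrite !inE; case zA : (z \in A j) => //=.
  rewrite (_ : z \in A i = false) //; apply/negP => zi.
  have := AXlt (si j js); rewrite disjoint_sym => /disjointFr/(_ (fintype.subsetP (AX j) z zA)).
  by rewrite zi.
have {}IH : #|[set U | balanced s U Q']|%:R <=
    2 ^+ #|Q'| * \prod_(i <- s) (Num.sqrt (t i))^-1.
  by apply: IH => // j js; rewrite dis //; apply: tA; rewrite inE js orbT.
pose fib U0 := [set U | balanced (i :: s) U Q & U :\: A i == U0].
have capD U j : (j < i)%N -> (U :\: A i) :&: X j = U :&: X j.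
  move=> ji; apply/setP => z; rewrite !inE; case zX : (z \in X j); rewrite ?andbF // !andbT.
  by have := AXlt ji; rewrite disjoint_sym => /disjointFr/(_ zX) ->.
have capDY U j : (j <= i)%N -> (U :\: A i) :&: Y j = U :&: Y j.
  move=> ji; apply/setP => z; rewrite !inE; case zX : (z \in Y j); rewrite ?andbF // !andbT.
  by have := AY ji; rewrite disjoint_sym => /disjointFr/(_ zX) ->.
have fibc U0 : #|fib U0|%:R <= 2 ^+ #|a| * (Num.sqrt (t i))^-1.
  (* Once the trace [U0] of [U] outside [A i] is fixed, [U :&: Y i] is known and only [U :&: A i]
     varies inside [U :&: X i]; balance at [i] then forces [#|U :&: A i| = m]. *)
  pose m := (#|U0 :&: Y i| - #|U0 :&: X i|)%N.
  have : (#|fib U0| <= 'C(#|a|, m))%N.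
    rewrite -cards_draws -(card_in_imset (f := fun U => U :&: A i) (D := fib U0)).
      apply: subset_leq_card; apply/fintype.subsetP => _ /imsetP[U + ->].
      rewrite !inE /balanced /= => /andP[/and3P[UQ /eqP E _] /eqP U0E].
      apply/andP; split; first by rewrite /a setIC setIS.
      have EX : #|U :&: X i| = (#|U :&: A i| + #|U0 :&: X i|)%N.
        rewrite -(cardsID (A i) (U :&: X i)); congr (_ + _)%N; apply: eq_card => z;
        rewrite -?U0E !inE; last by rewrite andbA [(_ \notin _) && _]andbC -andbA.
        case zA : (z \in A i); rewrite ?andbF // !andbT.
        by rewrite (fintype.subsetP (AX i) z zA) andbT.
      have EY : #|U :&: Y i| = #|U0 :&: Y i| by rewrite -U0E capDY.
      by apply/eqP; rewrite /m -EY -E EX addnK.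
    move=> U U'; rewrite !inE => /andP[_ /eqP UE] /andP[_ /eqP UE'] E.
    by rewrite -(finset.setID U (A i)) -(finset.setID U' (A i)) E UE UE'.
  move=> h; apply: (@le_trans _ _ 'C(#|a|, m)%:R); first by rewrite ler_nat.
  rewrite ler_pdivlMr ?sqrtr_gt0 //.
  rewrite -(@ler_pXn2r _ 2%N) ?nnegrE ?mulr_ge0 ?sqrtr_ge0 ?exprn_ge0 //.
  rewrite exprMn sqr_sqrtr ?(ltW ti0) //.
  apply: (@le_trans _ _ ('C(#|a|, m)%:R ^+ 2 * #|a|%:R)).
    by rewrite ler_wpM2l ?exprn_ge0.
  by rewrite -!natrX -natrM ler_nat -expnM [(#|a| * 2)%N]mulnC expnM (bin_sqr_le #|a| m).
have -> : #|[set U | balanced (i :: s) U Q]|%:R =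
    \sum_(U0 in [set U | balanced s U Q']) #|fib U0|%:R :> R.
  rewrite -natr_sum; congr (_%:R); rewrite -sum1_card.
  rewrite (partition_big (fun U => U :\: A i) (mem [set U | balanced s U Q'])) /=.
    apply: eq_bigr => U0 _; rewrite -sum1_card; apply: eq_bigl => U.
    by rewrite !inE.
  move=> U; rewrite !inE /balanced /= => /and3P[UQ _ /allP al].
  rewrite setSD //=; apply/allP => j js.
  by rewrite capD ?si // capDY ?al // ltnW // si.
apply: (@le_trans _ _ (\sum_(U0 in [set U | balanced s U Q'])
    2 ^+ #|a| * (Num.sqrt (t i))^-1)); first by apply: ler_sum.
rewrite sumr_const -[_ *+ _]mulr_natl big_cons.
have -> : #|Q| = (#|Q'| + #|a|)%N by rewrite -(cardsID (A i) Q) addnC /a finset.setIC.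
rewrite exprD.
apply: (@le_trans _ _ (2 ^+ #|Q'| * \prod_(i <- s) (Num.sqrt (t i))^-1 *
  (2 ^+ #|a| * (Num.sqrt (t i))^-1))); last by rewrite le_eqVlt; apply/orP; left; apply/eqP; ring.
by rewrite ler_wpM2r // mulr_ge0 ?exprn_ge0 ?invr_ge0 ?sqrtr_ge0.
Qed.

End TriangularCount.

(** Each point is included independently with probability [q]. By the Chernoff bounds, each of at
    most [#|J|.+1] bad events has probability at most [expR (- tau)], so some [Q] avoids them
    all. *)
Lemma exists_sample (R : realType) (T J : finType) (P : pred J) (A : J -> {set T})
    (q tau : R) : 0 <= q <= 1 ->
  (forall j, P j -> tau <= #|A j|%:R * q / 4) -> tau <= #|T|%:R * q ->
  (#|J|.+1)%:R * expR (- tau) < 1 ->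
  exists Q : {set T}, #|Q|%:R <= 4 * (#|T|%:R * q) /\
    (forall j, P j -> #|A j|%:R * q / 4 <= #|A j :&: Q|%:R).
Proof.
move=> q01 tA tT small; pose pq (_ : T) := q.
have pq01 e : 0 <= pq e <= 1 by [].
have loc z : local_on [set z] (fun Q : {set T} => z \in Q).
  by move=> G H /setP/(_ z); rewrite !inE eqxx !andbT.
have dis (Z : {set T}) : {in Z &, forall i j, i != j -> [disjoint [set i] & [set j]]}.
  by move=> i j _ _ ij; rewrite disjoints1 inE.
have prob z : bern_prob pq (fun Q : {set T} => z \in Q) = q.
  pose f e (b : bool) : R := if e == z then b%:R else 1.
  transitivity (bern_exp pq (fun G => \prod_e f e (e \in G))).
    apply: eq_bern_exp => G; rewrite (bigD1 z) //= /f eqxx big1 ?mulr1 // => e.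
    by move=> /negbTE ->.
  rewrite bern_exp_prod (bigD1 z) //= /f eqxx big1 => [|e /negbTE ->].
    by rewrite !mulr1 mulr0 addr0.
  by rewrite !mulr1 addrC subrK.
have lower j : P j ->
    bern_prob pq (fun Q => #|A j :&: Q|%:R <= #|A j|%:R * q / 4) <= expR (- tau).
  move=> Pj; apply: le_trans (_ : expR (- (#|A j|%:R * q / 4)) <= _); last first.
    by rewrite ler_expR lerN2 tA.
  apply: (@chernoff_lower R T pq pq01 T (A j) (fun z => [set z]) (fun z Q => z \in Q)) => //.
  by move=> z _; rewrite prob.
have upper : bern_prob pq (fun Q => 4 * (#|T|%:R * q) <= #|[set: T] :&: Q|%:R)
    <= expR (- tau).
  apply: le_trans (_ : expR (- (#|[set: T]|%:R * q)) <= _); last first.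
    by rewrite ler_expR lerN2 cardsT tT.
  rewrite -cardsT.
  apply: (@chernoff_upper R T pq pq01 T [set: T] (fun z => [set z]) (fun z Q => z \in Q)) => //.
  by move=> z _; rewrite prob.
pose bad Q := (4 * (#|T|%:R * q) <= #|[set: T] :&: Q|%:R) ||
  [exists j, P j && (#|A j :&: Q|%:R <= #|A j|%:R * q / 4)].
have badP : bern_prob pq bad < 1.
  apply: le_lt_trans small; apply: le_trans (bern_probU pq01 _ _) _.
  rewrite [leRHS](_ : _ = expR (- tau) + #|J|%:R * expR (- tau)); last first.
    by rewrite -addn1 natrD mulrDl mul1r addrC.
  apply: lerD => //.
  apply: le_trans (bern_prob_exists pq01 _ _) _.
  apply: (@le_trans _ _ (\sum_(j | P j) expR (- tau))); first by apply: ler_sum.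
  rewrite sumr_const -[_ *+ _]mulr_natl ler_wpM2r ?expR_ge0 // ler_nat.
  exact: max_card.
have [Q nbad] : exists Q, ~~ bad Q.
  apply/existsP; apply: contraLR badP; rewrite negb_exists => /forallP h.
  rewrite -leNgt -[leLHS](bern_exp1 pq); apply: ler_bern_exp => // G.
  by have := h G; rewrite negbK => ->.
move: nbad; rewrite negb_or -ltNge finset.setTI => /andP[Q4 /existsPn h].
exists Q; split; first exact: ltW.
by move=> j Pj; have := h j; rewrite Pj /= -ltNge => /ltW.
Qed.

Section Resolving.
Variables (T : finType) (G : {set {set T}}).
Implicit Types (u v w z : T) (S U : {set T}).

Definition gsphere v i := [set z | gdist G v z == Some i].

Lemma count_gdist v S i :
  count_mem (Some i) [seq gdist G v r | r in S] = #|S :&: gsphere v i|.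
Proof.
rewrite count_map -size_filter cardE; apply: perm_size; apply: uniq_perm.
- by rewrite filter_uniq ?enum_uniq.
- exact: enum_uniq.
by move=> z; rewrite mem_filter !mem_enum !inE andbC.
Qed.

(** For positive [i], these are the vertices at distance exactly [i] from [v] and more than [i] from
    [w]. *)
Definition private v w i := (gball G v i :\: gball G w i) :\: gball G v i.-1.

Lemma private_sub v w i : (0 < i)%N -> private v w i \subset gsphere v i.
Proof.
move=> i0; apply/fintype.subsetP => z; rewrite !inE => /and3P[h1 _ h2].
by case: i i0 h1 h2 => // i _ /= h1 h2; rewrite gdistS h2 h1.
Qed.

Lemma private_disjointr v w i j : (j <= i)%N -> [disjoint private v w i & gsphere w j].
Proof.
move=> ji; rewrite -setI_eq0; apply/eqP/setP => z; rewrite !inE.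
by apply/negP => /andP[/and3P[_ + _] /eqP E]; rewrite ball_gdist E ji.
Qed.

Lemma private_disjointl v w i j : (j < i)%N -> [disjoint private v w i & gsphere v j].
Proof.
move=> ji; rewrite -setI_eq0; apply/eqP/setP => z; rewrite !inE.
apply/negP => /andP[/and3P[+ _ _] /eqP E]; rewrite ball_gdist E.
by case: i ji => // i; rewrite ltnS => ->.
Qed.

(** [exists_sample] supplies a small [Q] meeting each private set in at least [mu i * q / 4] points.
    By [balanced_count], a given pair of vertices is left unresolved by at most a fraction 1/|T|^2
    of the subsets of [Q], so some subset resolves all pairs. *)
Lemma resolving_exists (R : realType) (k : nat) (s : seq nat) (mu : nat -> R)
    (q tau : R) :
  (0 < #|T|)%N -> 0 < q <= 1 ->
  pairwise (fun i j => (j < i)%N) s -> (forall i, i \in s -> (0 < i <= k)%N) ->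
  (forall v w i, v != w -> i \in s -> mu i <= #|private v w i|%:R) ->
  (forall i, i \in s -> 0 < mu i /\ tau <= mu i * q / 4) ->
  tau <= #|T|%:R * q ->
  ((#|T| * #|T| * k.+1).+1)%:R * expR (- tau) < 1 ->
  \prod_(i <- s) (Num.sqrt (mu i * q / 4))^-1 <= (#|T|%:R * #|T|%:R)^-1 ->
  exists2 U, multiset_resolving G U & #|U|%:R <= 4 * (#|T|%:R * q).
Proof.
move=> T0 /andP[q0 q1] ps sk mup mu0 tT small prodle.
have [||||Q [Q4 QA]] := @exists_sample R T (T * T * 'I_k.+1)%type
  (fun j => (j.1.1 != j.1.2) && ((j.2 : nat) \in s))
  (fun j => private j.1.1 j.1.2 j.2) q tau.
- by rewrite (ltW q0) q1.
- move=> [[v w] i] /= /andP[vw is_]; have [m0 h] := mu0 _ is_.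
  by apply: le_trans h _; rewrite !ler_pM2r ?invr_gt0 // mup.
- by [].
- by rewrite !card_prod card_ord.
have n0 : 0 < #|T|%:R :> R by rewrite ltr0n.
pose bad (vw : T * T) := [set U | balanced (gsphere vw.1) (gsphere vw.2) s U Q].
have badc vw : vw.1 != vw.2 -> #|bad vw|%:R <= 2 ^+ #|Q| * (#|T|%:R * #|T|%:R)^-1 :> R.
  case: vw => v w /= vw; apply: le_trans (_ : _ <= 2 ^+ #|Q| *
    \prod_(i <- s) (Num.sqrt (mu i * q / 4))^-1) _; last by rewrite ler_wpM2l ?exprn_ge0.
  (* [private_sub] asks for a positive radius; index 0, which does not occur in [s], is given the
     empty set. *)
  apply: (@balanced_count _ _ _ _ (fun i => if i is 0 then finset.set0 else private v w i)) => //.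
  - by case=> [|i]; [rewrite sub0set | exact: private_sub].
  - by case=> [|i] j ji; [rewrite disjoints_subset sub0set | exact: private_disjointr].
  - by case=> [|i] j ji //; exact: private_disjointl.
  move=> i is_; have [m0 _] := mu0 i is_; have /andP[i0 ik] := sk i is_.
  rewrite !mulr_gt0 ?invr_gt0 //=; case: i is_ i0 ik m0 => // i is_ _ ik m0.
  have := QA (v, w, Ordinal (ik : (i.+1 < k.+1)%N)); rewrite /= vw is_ => /(_ isT).
  by apply: le_trans; rewrite !ler_pM2r ?invr_gt0 // mup.
have [U /andP[UQ resU]] : exists U, (U \subset Q) && multiset_resolving G U.
  apply/existsP; apply: contraT => /existsPn none.
  have cov : powerset Q \subset \bigcup_(vw : T * T | vw.1 != vw.2) bad vw.
    apply/fintype.subsetP => U; rewrite powersetE => UQ.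
    have := none U; rewrite UQ /= => /forallPn[v /forallPn[w]].
    rewrite negb_imply negbK => /andP[vw pe]; apply/bigcupP; exists (v, w) => //.
    rewrite inE /balanced UQ /=; apply/allP => i _; rewrite -!count_gdist.
    by rewrite (permP pe).
  have : (#|powerset Q| <= \sum_(vw : T * T | vw.1 != vw.2) #|bad vw|)%N.
    apply: leq_trans (subset_leq_card cov) _.
    apply: (big_rec2 (fun (B : {set {set T}}) (m : nat) => (#|B| <= m)%N)) => [|vw B m _ h].
      by rewrite cards0.
    by apply: leq_trans (leq_card_setU _ _) _; rewrite leq_add2l.
  rewrite -(ler_nat R) card_powerset natrX natr_sum leNgt => /negP[].
  apply: (@le_lt_trans _ _ (\sum_(vw : T * T | vw.1 != vw.2)
     2 ^+ #|Q| * (#|T|%:R * #|T|%:R)^-1)); first by apply: ler_sum.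
  have : \sum_(vw : T * T) 2 ^+ #|Q| * (#|T|%:R * #|T|%:R)^-1 = 2 ^+ #|Q| :> R.
    rewrite sumr_const card_prod -[_ *+ _]mulr_natr natrM -mulrA mulVf ?mulr1 //.
    by rewrite mulf_neq0 // gt_eqF.
  (* The diagonal pairs, absent from the left-hand sum, make the inequality strict. *)
  move=> {2}<-; rewrite [ltRHS](bigID (fun vw : T * T => vw.1 != vw.2)) /= ltrDl.
  have /card_gt0P[v0 _] := T0; rewrite (bigD1 (v0, v0)) ?eqxx //=.
  rewrite ltr_pwDl ?mulr_gt0 ?exprn_gt0 ?invr_gt0 ?mulr_gt0 //.
  by apply: sumr_ge0 => *; rewrite mulr_ge0 ?exprn_ge0 // invr_ge0 mulr_ge0 // ltW.
exists U => //; apply: le_trans Q4; rewrite ler_nat; exact: subset_leq_card.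
Qed.

End Resolving.

(** * Lower bound on resolving sets *)

(** Reduces the comparison of multisets of bounded distances to that of finitely many
    multiplicities. *)
Lemma count_sum_values (k : nat) (a : pred (option nat)) (l : seq (option nat)) :
  all (fun x => if x is Some j then (j < k)%N else false) l ->
  count a l = (\sum_(j < k) a (Some (j : nat)) * count_mem (Some (j : nat)) l)%N.
Proof.
elim: l => [_|[y|] l IH] //=; first by rewrite big1 // => i _; rewrite muln0.
move=> /andP[yk /IH ->]; rewrite -[in LHS](big_mkord xpredT
  (fun j => a (Some j) * count_mem (Some j) l)%N).
under [RHS]eq_bigr do rewrite mulnDr.
rewrite big_split /= big_mkord; congr (_ + _)%N.
rewrite (bigD1 (Ordinal yk)) //= eqxx muln1 big1 ?addn0 // => i iy.
rewrite [_ == _](_ : _ = false) ?muln0 //.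
by apply: contraNF iy => /eqP[yi]; apply/eqP/val_inj.
Qed.

Section Symmetry.
Variables (T : finType) (G : {set {set T}}).

Lemma walkSl u v k : walk G u v k.+1 = [exists w, adj G u w && walk G w v k].
Proof.
apply/existsP/existsP => [[t]|[w /andP[e /existsP[t /andP[pt lt]]]]].
  case/tupleP: t => w t /= /andP[/andP[e pt] lt]; exists w; rewrite e /=.
  by apply/existsP; exists t; rewrite pt.
by exists [tuple of w :: t]; rewrite /= pt lt andbT e.
Qed.

Lemma walk_sym u v k : walk G u v k = walk G v u k.
Proof.
elim: k u v => [|k IH] u v; first by rewrite !walk0 eq_sym.
by rewrite walkS walkSl; apply: eq_existsb => w; rewrite IH andbC adjC.
Qed.

Lemma gball_sym u z i : (z \in gball G u i) = (u \in gball G z i).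
Proof. by apply/ballP/ballP => -[j ji]; rewrite walk_sym; exists j. Qed.

Lemma gsphere_sym u z i : (z \in gsphere G u i) = (u \in gsphere G z i).
Proof.
rewrite !inE; case: i => [|i]; first by rewrite !gdist0 eq_sym.
by rewrite !gdistS !(gball_sym z u).
Qed.

Lemma gsphere_sub u i : gsphere G u i \subset gball G u i.
Proof.
by apply/fintype.subsetP => z; rewrite inE ball_gdist => /eqP ->.
Qed.

End Symmetry.

Section SmallDiameter.
Variables (T : finType) (G : {set {set T}}) (k : nat).
Hypothesis diamG : forall u v, v \in gball G u k.+1.

(** All distances are at most [k.+1] and the multiplicities add up to [#|S|], so those at 0, ..., k
    determine the last one. *)
Lemma resolving_signature_inj S v w : multiset_resolving G S ->
  (forall i, (i <= k)%N -> #|S :&: gsphere G v i| = #|S :&: gsphere G w i|) -> v = w.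
Proof.
move=> /forallP/(_ v)/forallP/(_ w) res eqi; apply: contraTeq res => vw.
rewrite vw /= negbK.
have al u : all (fun x => if x is Some j then (j < k.+2)%N else false)
    [seq gdist G u r | r in S].
  by apply/allP => x /mapP[r _ ->]; have := diamG u r; rewrite ball_gdist; case: gdist.
have eqlt : forall i, (i <= k)%N -> count_mem (Some i) [seq gdist G v r | r in S] =
    count_mem (Some i) [seq gdist G w r | r in S].
  by move=> i ik; rewrite !count_gdist eqi.
have top : count_mem (Some k.+1) [seq gdist G v r | r in S] =
    count_mem (Some k.+1) [seq gdist G w r | r in S].
  have E u : #|S| = (\sum_(j < k.+1) count_mem (Some (j : nat)) [seq gdist G u r | r in S]
      + count_mem (Some k.+1) [seq gdist G u r | r in S])%N.
    rewrite cardE -(size_map (gdist G u)) -count_predT (count_sum_values _ (al u)).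
    rewrite big_ord_recr /= mul1n; congr (_ + _)%N.
    by apply: eq_bigr => i _; rewrite mul1n.
  apply: (@addnI (\sum_(j < k.+1) count_mem (Some (j : nat)) [seq gdist G v r | r in S])).
  rewrite -E (E w); congr (_ + _)%N; apply: eq_bigr => i _.
  by rewrite eqlt // -ltnS.
apply/permP => a; rewrite (count_sum_values a (al v)) (count_sum_values a (al w)).
apply: eq_bigr => i _; congr (_ * _)%N.
by have := ltn_ord i; rewrite ltnS leq_eqVlt => /orP[/eqP -> //|]; rewrite ltnS => /eqlt.
Qed.

(** Double counting shows that a ball of radius i contains on average at most b_i |S|/|T| points of
    [S]. By Markov's inequality at most a fraction 1/(2(k+1)) of the vertices exceed 2(k+1) times
    this bound, so at least half of them stay below it at all k + 1 radii; their signatures are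
    distinct points of a box. *)
Lemma resolving_count (R : realType) (b : nat -> R) S :
  (forall u i, (i <= k)%N -> #|gball G u i|%:R <= b i) -> multiset_resolving G S ->
  #|T|%:R / 2 <=
    \prod_(i < k.+1) (Num.truncn (2 * k.+1%:R * b i * #|S|%:R / #|T|%:R)).+1%:R :> R.
Proof.
move=> bG res.
have [T0|T0] := posnP #|T|.
  by rewrite T0 mul0r; apply: prodr_ge0.
have n0 : 0 < #|T|%:R :> R by rewrite ltr0n.
pose m i := 2 * k.+1%:R * b i * #|S|%:R / #|T|%:R.
pose X v i := #|S :&: gsphere G v i|.
pose bad i := [set v | m i < (X v i)%:R].
have k0 : 0 < k.+1%:R :> R by rewrite ltr0n.
have badc (i : 'I_k.+1) : #|bad i|%:R <= #|T|%:R / (2 * k.+1%:R) :> R.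
  have ik : (i <= k)%N by rewrite -ltnS.
  have [S0|S0] := posnP #|S|.
    rewrite (_ : bad i = finset.set0) ?cards0 ?divr_ge0 ?mulr_ge0 //.
    apply/setP => v; rewrite !inE /m S0 mulr0 mul0r /X.
    by move/eqP: S0; rewrite cards_eq0 => /eqP ->; rewrite finset.set0I cards0 ltxx.
  have /card_gt0P[u _] := T0.
  have b1 : 0 < b i.
    apply: lt_le_trans (bG u i ik); rewrite ltr0n card_gt0; apply/set0Pn.
    by exists u; exact: ball_self.
  have s0 : 0 < #|S|%:R :> R by rewrite ltr0n.
  have sumX : (\sum_v #|S :&: gball G v i| = \sum_(r in S) #|gball G r i|)%N.
    transitivity (\sum_v \sum_(r in S) (r \in gball G v i : nat))%N.
      apply: eq_bigr => v _; rewrite -sum1_card big_mkcond [RHS]big_mkcond /=.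
      by apply: eq_bigr => r _; rewrite inE; case: (r \in S); case: (r \in gball G v i).
    rewrite exchange_big /=; apply: eq_bigr => r _; rewrite -sum1_card [RHS]big_mkcond.
    by apply: eq_bigr => v _; rewrite gball_sym; case: ifP.
  have h : #|bad i|%:R * m i <= #|S|%:R * b i.
    apply: (@le_trans _ _ (\sum_v #|S :&: gball G v i|)%:R).
      rewrite natr_sum mulr_natl -sumr_const [leLHS]big_mkcond; apply: ler_sum => v _.
      case: ifP => // ; rewrite inE => /ltW/le_trans; apply.
      by rewrite ler_nat; apply: subset_leq_card; rewrite setIS // gsphere_sub.
    rewrite sumX natr_sum [leRHS]mulr_natl -sumr_const.
    by apply: ler_sum => r _; apply: bG.
  rewrite ler_pdivlMr ?mulr_gt0 //.
  rewrite -(ler_pM2r (_ : 0 < #|S|%:R * b i / #|T|%:R)) ?divr_gt0 ?mulr_gt0 //.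
  move: h; rewrite /m => h.
  rewrite [leRHS](_ : _ = #|S|%:R * b i); last by field; rewrite gt_eqF.
  apply: le_trans h; rewrite le_eqVlt; apply/orP; left; apply/eqP; ring.
pose good := ~: \bigcup_(i < k.+1) bad i.
have goodc : #|T|%:R / 2 <= #|good|%:R :> R.
  have hU : (#|\bigcup_(i < k.+1) bad i| <= \sum_(i < k.+1) #|bad i|)%N.
    apply: (big_rec2 (fun (B : {set T}) (m : nat) => (#|B| <= m)%N)) => [|i B m' _ h].
      by rewrite cards0.
    by apply: leq_trans (leq_card_setU _ _) _; rewrite leq_add2l.
  have hR : #|\bigcup_(i < k.+1) bad i|%:R <= #|T|%:R / 2 :> R.
    apply: le_trans (_ : (\sum_(i < k.+1) #|bad i|)%:R <= _); first by rewrite ler_nat.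
    rewrite natr_sum; apply: le_trans (_ : \sum_(i < k.+1) #|T|%:R / (2 * k.+1%:R) <= _).
      by apply: ler_sum => i _.
    rewrite sumr_const card_ord -[_ *+ _]mulr_natr le_eqVlt; apply/orP; left.
    by apply/eqP; field; rewrite gt_eqF // nat1r.
  have := congr1 (fun m => m%:R : R) (cardsC (\bigcup_(i < k.+1) bad i)).
  rewrite natrD -/good => E; lra.
apply: le_trans goodc _.
pose sig v : {ffun 'I_k.+1 -> 'I_#|T|.+1} := [ffun i : 'I_k.+1 => inord (X v i)].
have Xlt v i : (X v i < #|T|.+1)%N by rewrite ltnS max_card.
pose F (i : 'I_k.+1) := [pred j : 'I_#|T|.+1 | (j <= Num.truncn (m i))%N].
have sub : sig @: good \subset family F.
  apply/fintype.subsetP => _ /imsetP[v vg ->]; apply/familyP => i.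
  rewrite ffunE inE inordK //; move: vg; rewrite inE => /bigcupP h.
  have : ~~ (m i < (X v i)%:R) by apply/negP => h'; apply: h; exists i => //; rewrite inE.
  by rewrite -leNgt => h' /=; rewrite truncn_ge_nat //; apply: le_trans h'.
have inj : {in good &, injective sig}.
  move=> v w _ _ /ffunP E; apply: (resolving_signature_inj res) => i ik.
  have := congr1 val (E (Ordinal (ik : (i < k.+1)%N))).
  by rewrite !ffunE /= !inordK ?Xlt.
rewrite -(card_in_imset inj).
apply: (@le_trans _ _ #|family F|%:R); first by rewrite ler_nat subset_leq_card.
rewrite card_family foldrE big_map big_enum /= natr_prod; apply: ler_prod => i _.
rewrite ler0n ler_nat; have -> : #|F i| = size (map val (enum (F i))) by rewrite size_map -cardE.
rewrite -(size_iota 0 (Num.truncn (m i)).+1).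
apply: uniq_leq_size; first by rewrite map_inj_uniq ?enum_uniq //; exact: val_inj.
by move=> _ /mapP[j + ->]; rewrite mem_enum mem_iota ltnS.
Qed.

End SmallDiameter.

(** Membership in [S] and the number of neighbours in [S] determine the multiset. The bound
    [3 < #|T|] settles a singleton [S]: at least three vertices lie outside, with only the values 0
    and 1 available. *)
Lemma no_resolving_diam2 (T : finType) (G : {set {set T}}) (S : {set T}) :
  (forall u v, v \in gball G u 2) -> (3 < #|T|)%N -> ~~ multiset_resolving G S.
Proof.
move=> diam T4; apply/negP => res.
pose X v := #|S :&: gsphere G v 1|.
have sph0 v : gsphere G v 0 = [set v] by apply/setP => z; rewrite !inE gdist0.
have inj v w : (v \in S) = (w \in S) -> X v = X w -> v = w.
  move=> vw Xvw; apply: (resolving_signature_inj diam res) => -[_|[_|//]]; last exact: Xvw.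
  have capE u : #|S :&: [set u]| = (u \in S).
    have [uS|uS] := boolP (u \in S); first by rewrite (setIidPr _) ?sub1set // cards1.
    by apply/eqP; rewrite cards_eq0 setI_eq0 disjoint_sym disjoints1.
  by rewrite !sph0 !capE vw.
have not1 v : v \notin gsphere G v 1 by rewrite inE gdistS !ball_self.
case S_size : #|S| => [|[|m]].
- have : (#|T| <= #|'I_1|)%N.
    rewrite -cardsT -(card_imset [set: T] (f := fun=> (ord0 : 'I_1))) ?max_card //.
    move=> v w _; have S0 : S = finset.set0 by apply/eqP; rewrite -cards_eq0 S_size.
    by apply: inj; rewrite ?S0 ?inE // /X S0 !finset.set0I.
  by rewrite card_ord => h; have := leq_trans T4 h.
- have XS v : (X v < 2)%N by rewrite ltnS -S_size subset_leq_card ?subsetIl.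
  have : (#|~: S| <= #|'I_2|)%N.
    rewrite -(card_in_imset (f := fun v => inord (X v) : 'I_2) (D := ~: S)) ?max_card //.
    move=> v w; rewrite !inE => vS wS /(congr1 val); rewrite /= !inordK // => E.
    by apply: inj => //; rewrite (negbTE vS) (negbTE wS).
  by rewrite card_ord; have := cardsC S; rewrite S_size; move: T4; lia.
(* The degrees inside [S] of its vertices are distinct, hence take all values from 0 to |S| - 1; a
   vertex of [S] adjacent to all the others excludes one adjacent to none. *)
pose f v : 'I_m.+2 := inord (X v).
have XS v : v \in S -> (X v < m.+2)%N.
  move=> vS; rewrite -S_size; apply: proper_card; apply/properP; split; first exact: subsetIl.
  by exists v; rewrite // inE (negbTE (not1 v)) andbF.
have fS : f @: S = [set: 'I_m.+2].
  apply/eqP; rewrite eqEcard subsetT cardsT card_ord card_in_imset ?S_size ?leqnn //.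
  move=> v w vS wS /(congr1 val); rewrite /= !inordK ?XS // => E.
  by apply: inj => //; rewrite vS wS.
have /imsetP[v0 v0S /(congr1 val)] : ord0 \in f @: S by rewrite fS inE.
rewrite /= inordK ?XS // => X0.
have /imsetP[v1 v1S /(congr1 val)] : ord_max \in f @: S by rewrite fS inE.
rewrite /= inordK ?XS // => X1.
have v01 : v0 != v1 by apply: contra_eqN X0 => /eqP ->; rewrite -X1.
have sub : S :&: gsphere G v1 1 = S :\ v1.
  apply/eqP; rewrite eqEcard; apply/andP; split.
    apply/fintype.subsetP => z; rewrite !in_setI in_setD1 => /andP[-> zv].
    by rewrite andbT; apply: contraTneq zv => ->; exact: not1.
  by rewrite -[#|_ :&: _|]/(X v1) -X1; have := cardsD1 v1 S; rewrite v1S S_size; lia.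
have : v0 \in S :&: gsphere G v1 1 by rewrite sub !inE v01.
rewrite in_setI gsphere_sym => /andP[_ v10].
have : (0 < X v0)%N by rewrite card_gt0; apply/set0Pn; exists v1; rewrite in_setI v1S.
by rewrite -X0.
Qed.

Section MsDim.
Variables (R : realType) (T : finType) (G : {set {set T}}).

Lemma ms_dim_le U : multiset_resolving G U -> (ms_dim R G <= (#|U|%:R)%:E)%E.
Proof. by move=> h; rewrite /ms_dim; apply: bigmin_le_cond. Qed.

Lemma ms_dim_ge (a : R) : (forall U, multiset_resolving G U -> a <= #|U|%:R) ->
  (a%:E <= ms_dim R G)%E.
Proof.
by move=> h; apply: le_bigmin => [|U /h]; rewrite ?leey ?lee_fin.
Qed.

Lemma ms_dim_pinfty : (forall U : {set T}, ~~ multiset_resolving G U) ->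
  ms_dim R G = +oo%E.
Proof. by move=> h; rewrite /ms_dim big_pred0 // => U; rewrite (negbTE (h U)). Qed.

End MsDim.

(** * Typical random graphs *)

Section GoodGraph.
Variables (R : realType) (n : nat) (p C1 : R) (C2 k : nat).
Local Notation V := 'I_n.

(* [k.+1] stands for the integer part of [1 / x]. *)
Definition good (G : {set {set V}}) : bool :=
  [&& [forall v, #|nbr G v|%:R <= 4 * (n%:R * p)],
      expanding p (growth n p C1) C1 C2 G
    & [forall u, forall v, v \in gball G u k.+2]].

(** Union bound over the three failures. If degrees and expansion are as required but [v] is outside
    the ball of radius [k.+2] around [u], then [v] has no neighbour in the ball of radius [k.+1]
    around [u] in [delv G v], which is large by [ball_delv_lb]; [prob_far] applies. *)
Lemma prob_good (p01 : 0 < p <= 1 / 2) (n0 : (0 < n)%N) (C20 : (0 < C2)%N) :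
  4 * C1 <= n%:R * p -> p * (1 + 4 * (n%:R * p)) ^+ k <= C1 ->
  1 - (n%:R * expR (- ((n%:R - 1) * p))
       + 4 * (expR (n%:R * (n%:R ^+ C2 * expR (- growth n p C1))) - 1)
       + n%:R ^+ 2 * expR (- (p * growth n p C1 ^+ k.+1)))
    <= gnp_prob p good.
Proof.
have /andP[p0 p2] := p01; have p01' : 0 <= p <= 1 by apply/andP; split; lra.
move=> npC pC1; rewrite gnp_probE // (bern_probC (gnp_param p)).
rewrite lerD2l lerN2.
pose far (uv : V * V) (G : {set {set V}}) :=
  (growth n p C1 ^+ k.+1 <= #|gball (delv G uv.2) uv.1 k.+1|%:R) &&
     ~~ touches G uv.2 (gball (delv G uv.2) uv.1 k.+1).
pose isfar G := [exists uv : V * V, (uv.1 != uv.2) && far uv G].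
have np0 : 0 <= n%:R * p by rewrite mulr_ge0 // ltW.
have pC : p <= C1.
  by apply: le_trans pC1; rewrite ler_peMr ?(ltW p0) // exprn_ege1 // lerDl mulr_ge0.
have g0 : 0 <= growth n p C1.
  by rewrite /growth mulr_ge0 // divr_ge0 ?expR_ge0 // mulr_ge0 //; lra.
apply: (@le_trans _ _ (bern_prob (gnp_param p) (fun G =>
  (~~ [forall v, #|nbr G v|%:R <= 4 * (n%:R * p)] ||
   ~~ expanding p (growth n p C1) C1 C2 G) || isfar G))).
  apply: (ler_bern_prob (gnp_param01 p01')) => G; rewrite /good /= !negb_and.
  case deg : [forall v, _] => //=; case ex : (expanding _ _ _ _ _) => //= /forallPn[u /forallPn[v vu]].
  have uv : u != v by apply: contraNneq vu => ->; exact: (ball_self G v k.+2).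
  apply/existsP; exists (u, v); rewrite uv /far /=; apply/andP; split.
    by apply: (ball_delv_lb (ltW p0) g0 ex (fun w => forallP deg w) pC1).
  apply: contra vu => /existsP[s /andP[sB e]]; rewrite !inE; apply/orP; right.
  apply/existsP; exists s; rewrite e andbT.
  exact: (fintype.subsetP (ball_delv_sub G v u k.+1)).
apply: le_trans (bern_probU (gnp_param01 p01') _ _) _; apply: lerD.
  apply: le_trans (bern_probU (gnp_param01 p01') _ _) _; apply: lerD.
    exact: prob_max_degree.
  exact: prob_not_expanding.
apply: le_trans (bern_prob_exists (gnp_param01 p01') _ _) _.
apply: (@le_trans _ _ (\sum_(uv : V * V) expR (- (p * growth n p C1 ^+ k.+1)))).
  rewrite [leLHS]big_mkcond; apply: ler_sum => -[u v] _ /=.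
  by case: ifP => [uv|_]; [exact: prob_far | exact: expR_ge0].
by rewrite sumr_const card_prod card_ord -[_ *+ _]mulr_natl natrM -expr2.
Qed.

Lemma good_ball (G : {set {set V}}) (M : R) : good G -> 1 + 4 * (n%:R * p) <= M ->
  forall u i, #|gball G u i|%:R <= M ^+ i.
Proof.
move=> /and3P[/forallP deg _ _] M1 u i; apply: le_trans (ball_ub u i deg) _.
have np0 : 0 <= 4 * (n%:R * p) by apply: le_trans (deg u).
by rewrite lerXn2r ?nnegrE //; lra.
Qed.

(** The subtracted term bounds the ball of radius [i.-1] around [v]; [private_estimate] shows that
    it is of smaller order. *)
Lemma good_private (G : {set {set V}}) (M : R) : good G -> 0 <= p ->
  p * M ^+ k <= C1 -> 1 + 4 * (n%:R * p) <= M ->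
  (forall j, (j <= k)%N -> M ^+ j <= C2%:R * growth n p C1 ^+ j) ->
  forall v w i, v != w -> (0 < i <= k.+1)%N ->
    growth n p C1 ^+ i - M ^+ i.-1 <= #|private G v w i|%:R.
Proof.
move=> gG p0 pM M1 hC2 v w i vw /andP[i0 ik].
have /and3P[/forallP deg ex _] := gG.
have np0 : 0 <= 4 * (n%:R * p) by apply: le_trans (deg v).
have D1 j : (1 + 4 * (n%:R * p)) ^+ j <= M ^+ j by rewrite lerXn2r ?nnegrE //; lra.
have pC1 : p * (1 + 4 * (n%:R * p)) ^+ k <= C1.
  by apply: le_trans pM; rewrite ler_wpM2l.
have C10 : 0 <= C1 by apply: le_trans pC1; rewrite mulr_ge0 // exprn_ge0 //; lra.
have g0 : 0 <= growth n p C1.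
  by rewrite /growth mulr_ge0 ?divr_ge0 ?expR_ge0 ?mulr_ge0 //; lra.
have h : growth n p C1 ^+ i <= #|gball G v i :\: gball G w i|%:R.
  apply: (ball_diff_lb p0 g0 ex deg pC1 vw ik) => j jk.
  exact: le_trans (D1 j) (hC2 j jk).
have hb := good_ball gG M1 v i.-1.
rewrite lerBlDr; apply: le_trans h _; apply: le_trans (lerD (lexx _) hb).
rewrite -natrD ler_nat /private -(cardsID (gball G v i.-1) (_ :\: _)) addnC leq_add2l.
by apply: subset_leq_card; apply: subsetIr.
Qed.

End GoodGraph.

(** * The function f_x *)

Section Fsum.
Variables (R : realType) (x : R).
Hypothesis x0 : 0 < x.
Local Notation k := (Num.truncn (1 / x)).

Lemma trunc_inv_itv : x <= 1 -> k%:R * x <= 1 < k.+1%:R * x.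
Proof.
move=> x1; have /andP[h1 h2] : k%:R <= 1 / x < k.+1%:R by rewrite truncn_itv // divr_ge0 // ltW.
by rewrite -ler_pdivlMr // h1 /= -ltr_pdivrMr.
Qed.

Lemma fsum_continuous : continuous (fsum x).
Proof.
suff cont m : continuous (fun y => \sum_(i < m) Num.max (i%:R * x + y - 1) 0 : R).
  exact: cont.
elim: m => [|m IH].
  rewrite (_ : (fun y : R => _) = fun=> 0); first by move=> y; exact: cvg_cst.
  by apply/funext => y; rewrite big_ord0.
rewrite (_ : (fun y : R => _) = (fun y => \sum_(i < m) Num.max (i%:R * x + y - 1) 0 +
    Num.max (m%:R * x + y - 1) 0)); last by apply/funext => y; rewrite big_ord_recr.
move=> y; apply: cvgD; first exact: IH.
apply: (@continuous_max R R (fun z => m%:R * x + z - 1) (fun=> 0)); last exact: cvg_cst.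
by apply: cvgD; [apply: cvgD; [exact: cvg_cst | exact: cvg_id] | exact: cvg_cst].
Qed.

(** [fsum x] may vanish on an interval. Where it is positive, some summand is positive, hence
    strictly increasing, and no other one decreases. *)
Lemma fsum_smono y z : 0 < fsum x y -> y < z -> fsum x y < fsum x z.
Proof.
move=> f0 yz.
have [i yi] : exists i : 'I_k.+1, 0 < i%:R * x + y - 1.
  apply/existsP; apply: contraTT f0 => /existsPn h; rewrite -leNgt /fsum.
  by apply: sumr_le0 => i _; rewrite ge_max lexx andbT leNgt h.
rewrite /fsum (bigD1 i) //= [ltRHS](bigD1 i) //=; apply: ltr_leD.
  by rewrite gt_max !lt_max; apply/andP; split; apply/orP; left; lra.
apply: ler_sum => j _; rewrite ge_max !le_max lexx orbT andbT.
by apply/orP; left; lra.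
Qed.

Lemma fsum0 : x <= 1 -> fsum x 0 = 0.
Proof.
move=> x1; apply: big1 => i _; apply/max_idPr.
have /andP[h _] := trunc_inv_itv x1.
have ik : i%:R <= k%:R :> R by rewrite ler_nat -ltnS.
by have := ler_wpM2r (ltW x0) ik; lra.
Qed.

Lemma fsum1 : fsum x 1 = x * 'C(k.+1, 2)%:R.
Proof.
rewrite /fsum -triangular_sum natr_sum mulr_sumr big_mkord; apply: eq_bigr => i _.
by rewrite addrK mulrC; apply/max_idPl; rewrite mulr_ge0 // ltW.
Qed.

(** At y = 1 the sum is x k (k+1)/2, and (k+1) x > 1. *)
Lemma fsum1_gt : x <= 1 -> k%:R / 2 < fsum x 1.
Proof.
move=> x1; rewrite fsum1; have /andP[_ h] := trunc_inv_itv x1.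
have : 2 * 'C(k.+1, 2)%:R = k.+1%:R * k%:R :> R.
  by rewrite -natrM; have := mul_bin_diag k.+1 1; rewrite bin1 => <-; rewrite natrM.
have [k0|k0] := posnP k.
  move: h; rewrite k0; nra.
have : 0 < k%:R :> R by rewrite ltr0n.
nra.
Qed.

Lemma unique_solution_exists c : x <= 1 -> 0 < c < fsum x 1 ->
  exists y, unique_solution x c y.
Proof.
move=> x1 /andP[c0 c1].
have [||y] := @IVT R (fsum x) 0 1 c (@ler01 _) _ _.
- by apply: continuous_subspaceT; exact: fsum_continuous.
- by rewrite fsum0 // minElt maxElt; have := lt_trans c0 c1 => h; rewrite h (ltW c0) (ltW c1).
rewrite in_itv /= => /andP[y0 y1] fy; exists y; split.
  split=> //; apply/andP; split; rewrite lt_neqAle ?y0 ?y1 andbT.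
    by apply: contraTneq c0 => y00; rewrite -fy -y00 fsum0 // ltxx.
  by apply: contraTneq c1 => y11; rewrite -fy -y11 ltxx.
move=> z [_ fz]; case: (ltgtP y z) => // h.
  by have := fsum_smono (_ : 0 < fsum x y) h; rewrite fy fz ltxx => /(_ c0).
by have := fsum_smono (_ : 0 < fsum x z) h; rewrite fy fz ltxx => /(_ c0).
Qed.

End Fsum.

(** * Convergence with high probability *)

Local Open Scope classical_set_scope.
Local Open Scope ring_scope.

Section Asymptotics.
Variable R : realType.

Lemma powR_nat_ge (e B : R) : 0 < e -> \forall n \near \oo, B <= n%:R `^ e.
Proof.
move=> e0; near=> n.
have [B0|B0] := ltP B 0; first by apply: le_trans (ltW B0) (powR_ge0 _ _).
have h : B `^ e^-1 <= n%:R by near: n; exact: nbhs_infty_ger.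
rewrite -[leLHS](powRr1 B0) -[X in B `^ X](mulVf (lt0r_neq0 e0)) powRrM.
by rewrite ge0_ler_powR ?nnegrE ?powR_ge0 ?(ltW e0).
Unshelve. all: by end_near.
Qed.

(** With t = n^(e/2), ln n = (2/e) ln t <= (2/e) t, while one of the two factors t of n^e outgrows
    the constants. *)
Lemma ln_le_powR (e a M : R) : 0 < e -> 0 < a ->
  \forall n \near \oo, M * ln n%:R <= a * n%:R `^ e.
Proof.
move=> e0 a0; near=> n.
have n0 : 0 < n%:R :> R by rewrite ltr0n; near: n; exact: nbhs_infty_gt.
have e2 : 0 < e / 2 by rewrite divr_gt0.
have hB : `|M| * (2 / e) / a <= n%:R `^ (e / 2) by near: n; apply: powR_nat_ge; rewrite divr_gt0.
set t := n%:R `^ (e / 2) in hB *.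
have t0 : 0 < t by rewrite /t powR_gt0.
have lnt : ln n%:R = 2 / e * ln t :> R.
  by rewrite ln_powR mulrA; have -> : 2 / e * (e / 2) = 1 :> R; [field; rewrite gt_eqF | rewrite mul1r].
have -> : n%:R `^ e = t * t :> R.
  by rewrite -powRD; [congr (_ `^ _); lra | rewrite (gt_eqF n0) implybT].
have lt : ln t <= t by apply/ltW/ln_sublinear.
have [l0|l0] := leP (ln n%:R : R) 0.
  have [M0|M0] := leP 0 M; first by apply: le_trans (_ : 0 <= _); [nra | rewrite !mulr_ge0 // ltW].
  have n1 : 1 <= n%:R :> R by rewrite ler1n -(ltr0n R).
  by have := ln_ge0 n1 => l1; have -> : ln n%:R = 0 :> R; [lra | rewrite mulr0 !mulr_ge0 // ltW].
apply: (@le_trans _ _ (`|M| * ln n%:R)); first by rewrite ler_wpM2r ?ler_norm // ltW.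
rewrite lnt; apply: (@le_trans _ _ (`|M| * (2 / e) * t)).
  by rewrite [leLHS]mulrA ler_wpM2l // mulr_ge0 // divr_ge0 // ltW.
rewrite [leRHS]mulrA ler_pM2r //.
by rewrite ler_pdivrMr // [t * a]mulrC in hB.
Unshelve. all: by end_near.
Qed.

Lemma gnp_prob_le1 n (q : R) A : 0 <= q <= 1 -> @gnp_prob R n q A <= 1.
Proof. by move=> q01; rewrite gnp_probE bern_prob_le1 //; exact: gnp_param01. Qed.

Lemma gnp_prob_le n (q : R) (A B : pred {set {set 'I_n}}) : 0 <= q <= 1 ->
  (forall G, A G -> B G) -> gnp_prob q A <= gnp_prob q B.
Proof. by move=> q01 AB; rewrite !gnp_probE; apply: ler_bern_prob => //; exact: gnp_param01. Qed.

Variable p : nat -> R.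
Hypothesis p01 : forall n, 0 <= p n <= 1.

Lemma whp_lower_bound (K : R) (A : forall n, pred {set {set 'I_n}}) :
  (\forall n \near \oo, 1 - K / n%:R <= gnp_prob (p n) (A n)) -> whp p A.
Proof.
move=> h; apply/cvgrPdist_lt => e e0; near=> n.
have hn : 1 - K / n%:R <= gnp_prob (p n) (A n) by near: n.
have hle := gnp_prob_le1 (A n) (p01 n).
have n0 : 0 < n%:R :> R by rewrite ltr0n; near: n; exact: nbhs_infty_gt.
rewrite ger0_norm ?subr_ge0 //.
have : K / n%:R < e.
  by rewrite ltr_pdivrMr // mulrC -ltr_pdivrMr //; near: n; exact: nbhs_infty_gtr.
by lra.
Unshelve. all: by end_near.
Qed.

Lemma whp_le (A B : forall n, pred {set {set 'I_n}}) : whp p A ->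
  (\forall n \near \oo, forall G, A n G -> B n G) -> whp p B.
Proof.
move=> hA AB; apply: (@squeeze_cvgr _ _ _ _ (fun n => gnp_prob (p n) (A n)) (fun=> 1)) => //.
  near=> n; rewrite gnp_prob_le1 // andbT; apply: gnp_prob_le => //.
  by near: n.
exact: cvg_cst.
Unshelve. all: by end_near.
Qed.

(** Since delta(n) ln n is bounded by some C, n^delta(n) stays between e^(-C) and e^C. The factor 2
    in [b] passes from n - 1 to n. *)
Lemma degree_exponent_bounds x : degree_exponent p x ->
  exists a b : R, [/\ 0 < a <= 1, 1 <= b & \forall n \near \oo,
    a * n%:R `^ x <= (n%:R - 1) * p n /\ n%:R * p n <= b * n%:R `^ x].
Proof.
move=> [delta /eqO_exP[C C0 hC] hd].
exists (expR (- C)), (2 * expR C); split.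
- by rewrite expR_gt0 -[leRHS]expR0 ler_expR oppr_le0 ltW.
- by have := expR_ge1Dx C; lra.
near=> n.
have hdn : (n%:R - 1) * p n = n%:R `^ (x + delta n) by near: n.
have hCn : `|delta n| <= C * `|(ln n%:R)^-1| by near: n.
have n2 : 2 <= n%:R :> R by near: n; exact: nbhs_infty_ger.
have ln0 : 0 < ln n%:R :> R by apply: ln_gt0; lra.
have nn0 : n%:R != 0 :> R by rewrite gt_eqF //; lra.
have dl : `|delta n * ln n%:R| <= C.
  rewrite normrM (gtr0_norm ln0) -ler_pdivlMr //.
  have e1 : `|(ln n%:R)^-1| = (ln n%:R)^-1 :> R by rewrite ger0_norm // invr_ge0 ltW.
  by move: hCn; rewrite e1.
have -> : (n%:R - 1) * p n = n%:R `^ x * expR (delta n * ln n%:R).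
  rewrite hdn powRD; last by rewrite nn0 implybT.
  by rewrite [in X in _ * X]/powR (negbTE nn0).
move: dl; rewrite ler_norml => /andP[d1 d2].
have px := powR_ge0 (n%:R : R) x.
split; first by rewrite mulrC ler_wpM2l // ler_expR.
apply: (@le_trans _ _ (2 * ((n%:R - 1) * p n))).
  by have /andP[pn0 _] := p01 n; nra.
rewrite hdn powRD; last by rewrite nn0 implybT.
rewrite [in X in _ * (_ * X) <= _]/powR (negbTE nn0).
by rewrite -mulrA ler_pM2l // mulrC ler_wpM2r // ler_expR.
Unshelve. all: by end_near.
Qed.

(** What the three regimes need of the graph, with [D] standing for n^x: ball sizes for the lower
    bound, private sets for the upper bound, the diameter for the lower bound and the infinite
    case. *)
Definition typical n (D alpha beta : R) k (G : {set {set 'I_n}}) : bool :=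
  [&& [forall u, forall i : 'I_k.+1, #|gball G u i|%:R <= beta * D ^+ i],
      [forall v, forall w, forall i : 'I_k.+1, (v != w) && (0 < i)%N ==>
         (alpha * D ^+ i <= #|private G v w i|%:R)]
    & [forall u, forall v, v \in gball G u k.+1]].

End Asymptotics.

Section Typical.
Variable R : realType.

Lemma mul_expRN_le (n m : nat) (c : R) : (0 < n)%N -> m.+1%:R * ln n%:R <= c ->
  n%:R ^+ m * expR (- c) <= n%:R^-1.
Proof.
move=> n0 h; have n0' : 0 < n%:R :> R by rewrite ltr0n.
have e : expR (- c) <= n%:R ^- m.+1.
  rewrite expRN lef_pV2 ?posrE ?expR_gt0 ?exprn_gt0 //.
  rewrite -[n%:R in leLHS](lnK (_ : n%:R \is Num.pos)) ?posrE //.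
  by rewrite -expRM_natl ler_expR.
apply: (@le_trans _ _ (n%:R ^+ m * n%:R ^- m.+1)); first by rewrite ler_wpM2l ?exprn_ge0.
by rewrite exprSr invfM mulrA divff ?mul1r // expf_neq0 // gt_eqF.
Qed.

Lemma expR_sub1_le (t : R) : 0 <= t <= 1 / 2 -> expR t - 1 <= 2 * t.
Proof.
move=> /andP[t0 t2]; have h := expR_ge1Dx (- t).
have : expR t * expR (- t) = 1 by rewrite -expRD subrr expR0.
by have := expR_gt0 t; nra.
Qed.

Lemma powR_exprM (N : nat) (x : R) (i : nat) : (N%:R `^ x) ^+ i = N%:R `^ (i%:R * x).
Proof. by rewrite -powR_mulrn ?powR_ge0 // -powRrM mulrC. Qed.

Lemma degree_estimates (n k : nat) (q b D : R) : (0 < n)%N -> 0 <= q -> 1 <= D ->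
  1 <= b -> n%:R * q <= b * D -> D ^+ k.+1 <= n%:R ->
  1 + 4 * (n%:R * q) <= 5 * b * D /\ q * (5 * b * D) ^+ k <= (5 * b) ^+ k.+1.
Proof.
move=> n0 q0 D1 b1 nq Dk; have D0 : 0 < D by lra.
have b0 : 0 < b by lra.
have MD0 : 0 <= 5 * b * D by rewrite !mulr_ge0 ?(ltW b0) ?(ltW D0).
split; first by nra.
rewrite -(ler_pM2l (_ : 0 < n%:R)) ?ltr0n // mulrA.
apply: (@le_trans _ _ (b * D * (5 * b * D) ^+ k)); first by rewrite ler_wpM2r // exprn_ge0.
apply: (@le_trans _ _ ((5 * b * D) ^+ k.+1)).
  by rewrite exprS ler_wpM2r ?exprn_ge0 // ler_pM2r //; lra.
by rewrite exprMn mulrC ler_wpM2r // exprn_ge0 // mulr_ge0 // ltW.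
Qed.

(** As [ga <= 1 <= M], both exponents of the constants may be raised to [k]; for [D] large the
    subtracted term is then at most half of the main one. *)
Lemma private_estimate (k j : nat) (ga M D : R) : 0 < ga <= 1 -> 1 <= M -> 1 <= D ->
  2 * M ^+ k / ga ^+ k <= D -> (j < k)%N ->
  ga ^+ k / 2 * D ^+ j.+1 <= (ga * D) ^+ j.+1 - (M * D) ^+ j.
Proof.
move=> /andP[ga0 ga1] M1 D1 hD jk.
have h1 : ga ^+ k <= ga ^+ j.+1 by rewrite ler_wiXn2l // ltW.
have h2 : M ^+ j <= M ^+ k by rewrite ler_weXn2l // ltnW.
have h3 : 2 * M ^+ k <= ga ^+ k * D by rewrite [leRHS]mulrC -ler_pdivrMr // exprn_gt0.
rewrite !exprMn [D ^+ j.+1]exprS.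
have Dj : 0 < D ^+ j by rewrite exprn_gt0 //; lra.
have e : 0 <= ga ^+ j.+1 * D - ga ^+ k / 2 * D - M ^+ j by nra.
rewrite -subr_ge0.
have -> : ga ^+ j.+1 * (D * D ^+ j) - M ^+ j * D ^+ j - ga ^+ k / 2 * (D * D ^+ j) =
   (ga ^+ j.+1 * D - ga ^+ k / 2 * D - M ^+ j) * D ^+ j by ring.
by rewrite mulr_ge0 // ltW.
Qed.

Variables (p : nat -> R) (x : R).
Hypothesis p01 : forall n, 0 <= p n <= 1.
Hypothesis hd : degree_exponent p x.
Hypothesis x01 : 0 < x < 1.
Local Notation k := (Num.truncn (1 / x)).

Lemma typical_whp : exists alpha beta : R, [/\ 0 < alpha, 1 <= beta &
  whp p (fun n => typical (n%:R `^ x) alpha beta k)].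
Proof.
have /andP[x0 x1] := x01; have /andP[kx kx1] := trunc_inv_itv x0 (ltW x1).
have k0 : (0 < k)%N.
  by rewrite truncn_ge_nat ?divr_ge0 ?(ltW x0) // ler_pdivlMr // mul1r ltW.
(* From here on [k.+1] is the integer part of 1/x. *)
move: k k0 kx kx1 => [//|k] _ kx kx1.
have [a [b [/andP[a0 a1] b1 hab]]] := degree_exponent_bounds p01 hd.
(* Order of the constants: [M0] governs the growth of balls from above, [C1] bounds [p n] times the
   size of a ball of radius [k], [ga] is the resulting expansion rate relative to n^x, and [C2]
   bounds the ratio of the upper to the lower estimates of balls. *)
pose M0 := 5 * b; pose C1 := M0 ^+ k.+1.
have M01 : 1 <= M0 by rewrite /M0; lra.
have C11 : 1 <= C1 by apply: exprn_ege1.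
pose g := expR (- (2 * C1)) / (8 * (1 + C1)).
have g0 : 0 < g by rewrite divr_gt0 ?expR_gt0 // mulr_gt0 //; lra.
have g1 : g <= 1.
  rewrite ler_pdivrMr ?mul1r; last by rewrite mulr_gt0 //; lra.
  apply: (@le_trans _ _ 1); last by lra.
  by rewrite -[leRHS]expR0 ler_expR; lra.
pose ga := g * a.
have ga0 : 0 < ga by rewrite mulr_gt0.
have ga1 : ga <= 1 by rewrite mulr_ile1 // ltW.
pose C2 := (Num.truncn ((M0 / ga) ^+ k.+1)).+1.
have hC2 : (M0 / ga) ^+ k.+1 <= C2%:R by apply/ltW; exact: truncnS_gt.
have M0ga : 1 <= M0 / ga by rewrite ler_pdivlMr // mul1r; lra.
exists (ga ^+ k.+1 / 2), (M0 ^+ k.+1); split.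
- by rewrite divr_gt0 // exprn_gt0.
- by [].
pose Q n := @good R n (p n) C1 C2 k.
(* The expected number of edges from a vertex to a ball of radius [k.+1] is of order n^((k+2)x - 1),
   a positive power of n; this yields the diameter. *)
have ex1 : 0 < k.+2%:R * x - 1 by rewrite subr_gt0.
(* Each coefficient of [ln n%:R] exceeds by 1 the power of n in the matching error term of
   [prob_good], as [mul_expRN_le] asks. *)
have near_all : \forall n \near \oo, [/\ (2 <= n)%N,
    a * n%:R `^ x <= (n%:R - 1) * p n /\ n%:R * p n <= b * n%:R `^ x,
    [/\ 4 * C1 / a <= n%:R `^ x, 2 * M0 ^+ k.+1 / ga ^+ k.+1 <= n%:R `^ x &
        1 <= n%:R `^ x],
    2 * b <= n%:R `^ (1 - x) &
    [/\ 2 * ln n%:R <= a * n%:R `^ x, C2.+2%:R * ln n%:R <= ga * n%:R `^ x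
      & 3 * ln n%:R <= (a * ga ^+ k.+1) * n%:R `^ (k.+2%:R * x - 1)]].
  near=> n; split.
  - by near: n; exact: nbhs_infty_ge.
  - by near: n.
  - by split; near: n; apply: powR_nat_ge.
  - by near: n; apply: powR_nat_ge; rewrite subr_gt0.
  - split; near: n; apply: ln_le_powR => //.
    by rewrite mulr_gt0 // exprn_gt0.
have hQ : whp p Q.
  (* The three error terms are at most 1/n, 8/n and 1/n. *)
  apply: (@whp_lower_bound _ _ p01 10); apply: filterS near_all => n.
  move=> [n2 [an bn] [D1 D2 D3] nb [l1 l2 l3]].
  have n0 : (0 < n)%N by apply: leq_trans n2.
  have nR : 2 <= n%:R :> R by rewrite ler_nat.
  set D := n%:R `^ x in an bn D1 D2 D3 l1 l2.
  have /andP[pn0 pn1] := p01 n.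
  have aD : a * D <= n%:R * p n by lra.
  have pD : a * D / n%:R <= p n by rewrite ler_pdivrMr ?ltr0n // [leRHS]mulrC.
  have D0 : 0 < D by lra.
  have pp : 0 < p n by apply: lt_le_trans pD; rewrite divr_gt0 ?mulr_gt0 ?ltr0n.
  have nD : D * n%:R `^ (1 - x) = n%:R.
    rewrite -powRD; last by rewrite pnatr_eq0 -lt0n n0 implybT.
    by rewrite addrC subrK powRr1.
  have p2 : p n <= 1 / 2.
    have : n%:R * p n <= n%:R / 2.
      by apply: le_trans bn _; rewrite -nD mulrC -mulrA ler_wpM2l ?(ltW D0) //; lra.
    by move=> h; rewrite -(ler_pM2l (_ : 0 < n%:R)) ?ltr0n // mul1r.
  have gD : ga * D <= growth n (p n) C1.
    by rewrite /growth -/g /ga -mulrA ler_pM2l.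
  have Dk : D ^+ k.+1 <= n%:R.
    by rewrite powR_exprM -[leRHS]powRr1 // ler_powR // ler1n.
  have [MD pM] := degree_estimates n0 pn0 D3 b1 bn Dk; rewrite -/M0 in MD pM.
  have := @prob_good R n (p n) C1 C2 k _ n0 isT _ _.
  rewrite pp p2 => /(_ isT) h; apply: le_trans (h _ _); last 2 first.
  - by apply: le_trans aD; rewrite [leRHS]mulrC -ler_pdivrMr.
  - have h0 : 0 <= 1 + 4 * (n%:R * p n) by rewrite addr_ge0 // !mulr_ge0.
    apply: le_trans pM; apply: ler_wpM2l => //.
    by apply: lerXn2r; rewrite ?nnegrE // (le_trans h0 MD).
  rewrite lerD2l lerN2.
  have t1 : n%:R * expR (- ((n%:R - 1) * p n)) <= n%:R^-1.
    by have := @mul_expRN_le n 1 ((n%:R - 1) * p n) n0; rewrite expr1; apply; lra.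
  have t3 : n%:R ^+ 2 * expR (- (p n * growth n (p n) C1 ^+ k.+1)) <= n%:R^-1.
    apply: mul_expRN_le => //; apply: le_trans l3 _.
    apply: (@le_trans _ _ (a * D / n%:R * (ga * D) ^+ k.+1)); last first.
      have gaD0 : 0 <= ga * D by rewrite mulr_ge0 // ltW.
      apply: ler_pM => //.
      - by rewrite divr_ge0 // mulr_ge0 // ltW.
      - by rewrite exprn_ge0.
      - by apply: lerXn2r; rewrite ?nnegrE // (le_trans gaD0 gD).
    have -> : a * D / n%:R * (ga * D) ^+ k.+1 = a * ga ^+ k.+1 * (D ^+ k.+2 / n%:R).
      by rewrite exprMn [D ^+ k.+2]exprS; ring.
    rewrite ler_pM2l ?mulr_gt0 ?exprn_gt0 // powR_exprM powRD; last first.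
      by rewrite pnatr_eq0 -lt0n n0 implybT.
    by rewrite powRN powRr1.
  have t2 : 4 * (expR (n%:R * (n%:R ^+ C2 * expR (- growth n (p n) C1))) - 1) <= 8 * n%:R^-1.
    have hr : n%:R * (n%:R ^+ C2 * expR (- growth n (p n) C1)) <= n%:R^-1.
      by rewrite mulrA -exprS; apply: mul_expRN_le => //; apply: le_trans gD.
    set r := n%:R * _ in hr *.
    have r0 : 0 <= r by rewrite /r !mulr_ge0 ?exprn_ge0 ?expR_ge0.
    have n12 : n%:R^-1 <= 1 / 2 :> R by rewrite div1r lef_pV2 ?posrE ?ltr0n.
    have := @expR_sub1_le r; rewrite r0 (le_trans hr n12) => /(_ isT); lra.
  lra.
apply: (whp_le p01 hQ); apply: filterS near_all => n.
move=> [n2 [an bn] [D1 D2 D3] nb [l1 l2 l3]] G gG.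
have n0 : (0 < n)%N by apply: leq_trans n2.
have nR : 2 <= n%:R :> R by rewrite ler_nat.
set D := n%:R `^ x in an bn D1 D2 D3 l1 l2 *.
have D0 : 0 < D by lra.
have /andP[pn0 pn1] := p01 n.
have aD : a * D <= n%:R * p n by lra.
have gD : ga * D <= growth n (p n) C1 by rewrite /growth -/g /ga -mulrA ler_pM2l.
have Dk : D ^+ k.+1 <= n%:R by rewrite powR_exprM -[leRHS]powRr1 // ler_powR // ler1n.
have [MD pM] := degree_estimates n0 pn0 D3 b1 bn Dk; rewrite -/M0 in MD pM.
have /and3P[_ _ diam] := gG.
apply/and3P; split => //.
- apply/forallP => u; apply/forallP => i.
  apply: le_trans (good_ball gG MD u i) _; rewrite exprMn ler_wpM2r ?exprn_ge0 ?(ltW D0) //.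
  by rewrite ler_weXn2l // -ltnS.
apply/forallP => v; apply/forallP => w; apply/forallP => i; apply/implyP => /andP[vw i0].
have ik : (i <= k.+1)%N by rewrite -ltnS.
apply: le_trans (good_private gG pn0 pM MD _ vw _); last 1 first.
- by rewrite i0.
- case: (nat_of_ord i) i0 ik => // j _ jk /=.
  apply: (@le_trans _ _ ((ga * D) ^+ j.+1 - (M0 * D) ^+ j)); last first.
    rewrite lerD2r lerXn2r ?nnegrE //; first by rewrite mulr_ge0 // ltW.
    by apply: le_trans gD; rewrite mulr_ge0 // ltW.
  by apply: private_estimate => //; apply/andP.
- move=> j jk; apply: (@le_trans _ _ (C2%:R * (ga * D) ^+ j)); last first.
    rewrite ler_wpM2l // lerXn2r ?nnegrE //; first by rewrite mulr_ge0 // ltW.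
    by apply: le_trans gD; rewrite mulr_ge0 // ltW.
  rewrite (exprMn j M0 D) (exprMn j ga D) mulrA ler_pM2r ?exprn_gt0 // -ler_pdivrMr ?exprn_gt0 //.
  rewrite -expr_div_n; apply: le_trans hC2; rewrite ler_weXn2l //.
  exact: leq_trans jk _.
Unshelve. all: by end_near.
Qed.

End Typical.

(** * The three regimes *)

Section Exponents.
Variable R : realType.

Lemma O_inv_log_const (c : R) : O_inv_log (fun n => c / ln n%:R).
Proof.
apply/eqO_exP; exists (`|c| + 1); first by rewrite ltr_wpDl.
by near=> n; rewrite normrM ler_wpM2r // lerDl.
Unshelve. all: by end_near.
Qed.

(** Constant factors are absorbed in this way into an exponent of order 1/log n. *)
Lemma powR_addDln (n : nat) (y c : R) : (1 < n)%N ->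
  n%:R `^ (y + c / ln n%:R) = n%:R `^ y * expR c.
Proof.
move=> n1; have l0 : 0 < ln n%:R :> R by rewrite ln_gt0 // ltr1n.
have n0 : n%:R != 0 :> R by rewrite pnatr_eq0; lia.
rewrite powRD; last by rewrite n0 implybT.
by rewrite [X in _ * X = _]/powR (negbTE n0) divfK // gt_eqF.
Qed.

Lemma near_all_seq (s : seq nat) (P : nat -> nat -> Prop) :
  (forall i, i \in s -> \forall n \near \oo, P i n) ->
  \forall n \near \oo, forall i, i \in s -> P i n.
Proof.
elim: s => [_|j s IH h]; first by apply: nearW => n i; rewrite in_nil.
have hj := h j (mem_head _ _).
have {}IH := IH (fun i is_ => h i (mem_behead (is_ : i \in behead (j :: s)))).
near=> n => i; rewrite inE => /orP[/eqP ->|is_]; first by near: n.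
by move: i is_; near: n.
Unshelve. all: by end_near.
Qed.

Lemma prod_powR (I : Type) (s : seq I) (P : pred I) (e : I -> R) (a : R) : 0 < a ->
  \prod_(i <- s | P i) a `^ e i = a `^ (\sum_(i <- s | P i) e i).
Proof.
move=> a0; elim: s => [|i s IH]; first by rewrite !big_nil powRr0.
rewrite !big_cons; case: ifP => // _.
by rewrite IH powRD // (gt_eqF a0) implybT.
Qed.

Variable x : R.
Local Notation k := (Num.truncn (1 / x)).

(** The radii that contribute to [fsum]; radius 0 is left out, as y - 1 is negative for y < 1. The
    order is decreasing, as in [balanced_count]. *)
Definition pos_indices (y : R) := [seq i <- rev (iota 1 k) | 0 < i%:R * x + y - 1].

Lemma sum_pos_indices y : y < 1 ->
  \sum_(i <- pos_indices y) (i%:R * x + y - 1) = fsum x y.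
Proof.
move=> y1; rewrite /fsum big_ord_recl big_filter (perm_big (iota 1 k)) /=; last first.
  by rewrite perm_rev.
rewrite (max_idPr _); last by rewrite mul0r; lra.
rewrite add0r -[iota 1 k]/(iota (1 + 0) k) iotaDl big_map.
rewrite -[in RHS](big_mkord xpredT (fun i => Num.max (i.+1%:R * x + y - 1) 0)).
rewrite /index_iota subn0 big_mkcond; apply: eq_bigr => i _.
by rewrite add1n; case: (ltP 0 (i.+1%:R * x + y - 1)).
Qed.

Lemma pairwise_pos_indices y : pairwise (fun i j => (j < i)%N) (pos_indices y).
Proof.
apply: pairwise_filter; rewrite -sorted_pairwise; last first.
  by move=> a b c /= h1 h2; apply: ltn_trans h2 h1.
by rewrite rev_sorted iota_ltn_sorted.
Qed.

Lemma mem_pos_indices y i : i \in pos_indices y ->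
  (0 < i <= k)%N /\ 0 < i%:R * x + y - 1.
Proof. by rewrite mem_filter mem_rev mem_iota add1n ltnS => /andP[-> ->]. Qed.

End Exponents.

Section TypicalGraphs.
Variables (R : realType) (p : nat -> R) (x : R).
Hypothesis p01 : forall n, 0 <= p n <= 1.
Hypothesis hd : degree_exponent p x.
Local Notation k := (Num.truncn (1 / x)).

Lemma typical_upper (alpha y : R) : 0 < x <= 1 -> 0 < alpha -> 0 < y < 1 ->
  fsum x y = 4 ->
  \forall n \near \oo, forall (beta : R) (G : {set {set 'I_n}}),
    typical (n%:R `^ x) alpha beta k G ->
    exists2 U, multiset_resolving G U & #|U|%:R <= 16 / alpha * n%:R `^ y.
Proof.
move=> /andP[x0 x1] a0 /andP[y0 y1] fy; set s := pos_indices x y.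
have lnpow i : i \in s -> \forall n \near \oo, 4 * ln n%:R <= 1 * n%:R `^ (i%:R * x + y - 1) :> R.
  by move=> /mem_pos_indices[_ h]; apply: ln_le_powR.
near=> n => beta G /and3P[_ /forallP priv _].
have n0 : (0 < n)%N by near: n; exact: nbhs_infty_gt.
have nk : (k.+2 <= n)%N by near: n; exact: nbhs_infty_ge.
have nR : 0 < n%:R :> R by rewrite ltr0n.
(* The density is chosen to make [mu i * q / 4] exactly n^(ix+y-1). *)
pose q := 4 / alpha * n%:R `^ (y - 1).
pose mu i := alpha * (n%:R `^ x) ^+ i.
have muE i : mu i * q / 4 = n%:R `^ (i%:R * x + y - 1).
  rewrite /mu /q powR_exprM -addrA [RHS]powRD; last by rewrite (gt_eqF nR) implybT.
  by field; rewrite gt_eqF.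
have nq : n%:R * q = 4 / alpha * n%:R `^ y.
  rewrite /q powRD; last by rewrite (gt_eqF nR) implybT.
  by rewrite powRN powRr1 ?ler0n //; field; rewrite !gt_eqF.
have q01 : 0 < q <= 1.
  rewrite !mulr_gt0 ?invr_gt0 ?powR_gt0 //=.
  rewrite /q -opprB powRN ler_pdivrMr ?powR_gt0 // mul1r.
  by near: n; apply: powR_nat_ge; rewrite subr_gt0.
(* With tau = 4 ln n each bad event has probability at most n^(-4), against a number of events of
   order n^2. *)
have := @resolving_exists 'I_n G R k s mu q (4 * ln n%:R); rewrite card_ord nq => h.
have [|||||||||U resU Us] := h; last 1 first.
- by exists U => //; apply: le_trans Us _; rewrite mulrA ler_wpM2r ?powR_ge0 //; lra.
- by [].
- by [].
- exact: pairwise_pos_indices.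
- by move=> i /mem_pos_indices[].
- move=> v w i vw /mem_pos_indices[/andP[i0 ik] _].
  have := priv v => /forallP/(_ w)/forallP/(_ (Ordinal (ik : (i < k.+1)%N))).
  by rewrite vw i0.
- move=> i is_; split; first by rewrite mulr_gt0 // exprn_gt0 // powR_gt0.
  rewrite muE -[leRHS]mul1r; move: i is_; near: n.
  exact: near_all_seq.
- near: n; apply: ln_le_powR => //; exact: divr_gt0.
- have e4 : expR (- (4 * ln n%:R)) = n%:R ^- 4 :> R.
    by rewrite expRN -[4]/(4%:R) expRM_natl lnK ?posrE.
  rewrite e4 ltr_pdivrMr ?exprn_gt0 // [ltRHS]mul1r -natrX ltr_nat.
  apply: (@leq_trans (n * n * n).+1); last by rewrite !expnS expn0; nia.
  have : (n * n * k.+2 <= n * n * n)%N by rewrite leq_mul2l nk orbT.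
  nia.
(* The product is n^(-f/2) with f = [fsum x y] = 4, that is n^(-2). *)
- rewrite (eq_bigr (fun i => n%:R `^ ((- 2^-1) * (i%:R * x + y - 1)))); last first.
    move=> i _; rewrite muE -powR12_sqrt ?powR_ge0 // -powRrM -powRN; congr (_ `^ _); ring.
  rewrite prod_powR // -mulr_sumr sum_pos_indices // fy.
  rewrite (_ : - 2^-1 * 4 = - (2%:R)); last by lra.
  by rewrite powRN powR_mulrn // expr2.
Unshelve. all: by end_near.
Qed.

(** For a smaller [U], the factor of [resolving_count] at radius i is 1 if ix + y - 1 <= 0, and
    otherwise at most n^(ix+y-1)/8 + 1 <= n^(ix+y-1)/4. As [fsum x y = 1], the product is at most
    n/4, below the required n/2. *)
Lemma typical_lower (beta y : R) : 0 < x <= 1 -> 1 <= beta -> 0 < y < 1 ->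
  fsum x y = 1 ->
  \forall n \near \oo, forall (alpha : R) (G : {set {set 'I_n}}) U,
    typical (n%:R `^ x) alpha beta k G -> multiset_resolving G U ->
    (16 * k.+1%:R * beta)^-1 * n%:R `^ y <= #|U|%:R.
Proof.
move=> /andP[x0 x1] b1 /andP[y0 y1] fy; set s := pos_indices x y.
have big8 i : i \in s -> \forall n \near \oo, 8 <= n%:R `^ (i%:R * x + y - 1) :> R.
  by move=> /mem_pos_indices[_ h]; apply: powR_nat_ge.
near=> n => alpha G U /and3P[/forallP ballb _ /forallP diam] res.
have n0 : (0 < n)%N by near: n; exact: nbhs_infty_gt.
have nR : 0 < n%:R :> R by rewrite ltr0n.
have k0 : 0 < k.+1%:R :> R by rewrite ltr0n.
have b0 : 0 < beta by lra.
have h8 : forall i, i \in s -> 8 <= n%:R `^ (i%:R * x + y - 1) :> R.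
  by near: n; exact: near_all_seq.
rewrite leNgt; apply/negP => small.
have := @resolving_count 'I_n G k (fun u => forallP (diam u)) R
  (fun i => beta * (n%:R `^ x) ^+ i) U _ res.
rewrite card_ord => /(_ _) h.
have {}h := h (fun u i ik => forallP (ballb u) (Ordinal (ik : (i < k.+1)%N))).
move: h; apply/negP; rewrite -ltNge.
pose e (i : nat) := i%:R * x + y - 1.
have mle (i : nat) : 2 * k.+1%:R * (beta * (n%:R `^ x) ^+ i) * #|U|%:R / n%:R
    <= n%:R `^ e i / 8.
  have -> : n%:R `^ e i / 8 = 2 * k.+1%:R * (beta * (n%:R `^ x) ^+ i) *
      ((16 * k.+1%:R * beta)^-1 * n%:R `^ y) / n%:R.
    rewrite /e -addrA powRD; last by rewrite (gt_eqF nR) implybT.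
    rewrite powRD; last by rewrite (gt_eqF nR) implybT.
    rewrite powRN powRr1 ?ler0n // powR_exprM.
    by field; rewrite !gt_eqF.
  rewrite ler_pM2r ?invr_gt0 // ler_wpM2l ?(ltW small) //.
  by rewrite !mulr_ge0 ?exprn_ge0 ?powR_ge0 // ltW.
have m0 (i : nat) : 0 <= 2 * k.+1%:R * (beta * (n%:R `^ x) ^+ i) * #|U|%:R / n%:R.
  by rewrite !mulr_ge0 ?invr_ge0 ?exprn_ge0 ?powR_ge0 ?(ltW b0) ?ler0n.
apply: (@le_lt_trans _ _ (\prod_(i < k.+1 | 0 < e i) (n%:R `^ e i / 4))).
  rewrite [leRHS]big_mkcond; apply: ler_prod => i _; rewrite ler0n /=.
  set m := _ / n%:R; have hm : m <= n%:R `^ e i / 8 by exact: mle.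
  have hm0 : 0 <= m by exact: m0.
  case: ifP => [ei|/negbT]; last first.
    rewrite -leNgt => ei; have : n%:R `^ e i <= 1 by rewrite -[leRHS](powRr0 n%:R) ler_powR // ler1n.
    move=> h1; have : (Num.truncn m < 1)%N by rewrite truncn_lt_nat //; lra.
    by rewrite ltnS leqn0 => /eqP ->.
  have : 8 <= n%:R `^ e i.
    have [i0|i0] := posnP i.
      by move: ei; rewrite /e i0 mul0r => ei; exfalso; lra.
    apply: h8; rewrite mem_filter ei mem_rev mem_iota i0 /= add1n; exact: ltn_ord.
  have /andP[tm _] := truncn_itv hm0.
  by rewrite -natr1; lra.
have fE : fsum x y = \sum_(i < k.+1 | 0 < e i) e i.
  rewrite /fsum [RHS]big_mkcond; apply: eq_bigr => i _; rewrite /e.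
  by case: ltP.
(* At least one factor 1/4 is present, because [fsum x y] is not 0. *)
have [i0 ei0] : exists i : 'I_k.+1, 0 < e i.
  apply/existsP; apply: contraT => /existsPn none.
  by move: fy; rewrite fE big_pred0 => [/eqP|i]; [rewrite eq_sym oner_eq0 | exact/negbTE].
rewrite big_split /= prod_powR // -fE fy powRr1 ?ler0n //.
rewrite ltr_pM2l // prodr_const; apply: (@le_lt_trans _ _ (4^-1 : R)); last by lra.
rewrite -[leRHS]expr1 ler_wiXn2l //; first by lra.
by apply/card_gt0P; exists i0.
Unshelve. all: by end_near.
Qed.

End TypicalGraphs.

(** The integer part of 1/x is at least [m.+1], hence at least 2c, and [fsum1_gt] gives a value
    above c at y = 1. *)
Lemma unique_solution_nat (R : realType) (x : R) (m c : nat) :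
  0 < x <= 1 / m.+1%:R -> (0 < c)%N -> (c.*2 <= m.+1)%N ->
  exists y : R, unique_solution x c%:R y.
Proof.
move=> /andP[x0 xm] c0 cm.
have m0 : 0 < m.+1%:R :> R by rewrite ltr0n.
have x1 : x <= 1 by apply: le_trans xm _; rewrite ler_pdivrMr // mul1r ler1n.
apply: unique_solution_exists => //; rewrite ltr0n c0 /=.
apply: le_lt_trans (fsum1_gt x0 x1).
rewrite ler_pdivlMr // -natrM ler_nat muln2; apply: leq_trans cm _.
rewrite truncn_ge_nat ?divr_ge0 ?(ltW x0) // ler_pdivlMr // mulrC -ler_pdivlMr //.
Qed.

Section Regimes.
Variables (R : realType) (p : nat -> R) (x : R).
Hypothesis p01 : forall n, 0 <= p n <= 1.
Hypothesis hd : degree_exponent p x.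

Lemma whp_ms_dim_le (y : R) : 0 < x < 1 -> 0 < y < 1 -> fsum x y = 4 ->
  exists2 g : nat -> R, O_inv_log g &
    whp p (fun n G => (ms_dim R G <= (n%:R `^ (y + g n))%:E)%E).
Proof.
move=> x01 y01 fy; have /andP[x0 x1] := x01.
have [alpha [beta [a0 b1 hwhp]]] := typical_whp p01 hd x01.
exists (fun n => ln (16 / alpha) / ln n%:R); first exact: O_inv_log_const.
have x01' : 0 < x <= 1 by rewrite x0 ltW.
apply: (whp_le p01 hwhp); have up := typical_upper x01' a0 y01 fy.
near=> n => G tG.
have [U resU Us] : exists2 U, multiset_resolving G U & #|U|%:R <= 16 / alpha * n%:R `^ y.
  by move: (beta) G tG; near: n.
apply: le_trans (ms_dim_le R resU) _; rewrite lee_fin powR_addDln; last first.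
  by near: n; exact: nbhs_infty_gt.
by rewrite lnK ?posrE ?divr_gt0 // mulrC.
Unshelve. all: by end_near.
Qed.

Lemma whp_ms_dim_ge (y : R) : 0 < x < 1 -> 0 < y < 1 -> fsum x y = 1 ->
  exists2 h : nat -> R, O_inv_log h &
    whp p (fun n G => ((n%:R `^ (y + h n))%:E <= ms_dim R G)%E).
Proof.
move=> x01 y01 fy; have /andP[x0 x1] := x01.
have [alpha [beta [a0 b1 hwhp]]] := typical_whp p01 hd x01.
pose c := (16 * (Num.truncn (1 / x)).+1%:R * beta)^-1.
exists (fun n => ln c / ln n%:R); first exact: O_inv_log_const.
have x01' : 0 < x <= 1 by rewrite x0 ltW.
have c0 : 0 < c by rewrite invr_gt0 !mulr_gt0 // (lt_le_trans _ b1).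
apply: (whp_le p01 hwhp); have low := typical_lower x01' b1 y01 fy.
near=> n => G tG; apply: ms_dim_ge => U resU.
rewrite powR_addDln; last by near: n; exact: nbhs_infty_gt.
rewrite lnK ?posrE // mulrC; move: (alpha) G U tG resU.
by near: n.
Unshelve. all: by end_near.
Qed.

Lemma whp_ms_dim_pinfty : 1 / 2 < x < 1 -> whp p (fun n G => ms_dim R G == +oo%E).
Proof.
move=> /andP[x2 x1]; have x0 : 0 < x by apply: lt_trans x2.
have x01 : 0 < x < 1 by rewrite x0.
have [alpha [beta [_ _ hwhp]]] := typical_whp p01 hd x01.
(* The integer part of 1/x is 1, so typical graphs have diameter at most 2. *)
have k1 : Num.truncn (1 / x) = 1%N.
  have x0' : 0 <= 1 / x by rewrite divr_ge0 // ltW.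
  apply/eqP; rewrite eqn_leq -ltnS truncn_lt_nat // truncn_ge_nat //.
  by rewrite ltr_pdivrMr // ler_pdivlMr // mul1r (ltW x1) andbT; lra.
apply: (whp_le p01 hwhp); near=> n => G; rewrite /typical k1 => /and3P[_ _ /forallP diam].
apply/eqP/ms_dim_pinfty => U; apply: no_resolving_diam2.
  by move=> u v; exact: (forallP (diam u)).
by rewrite card_ord; near: n; exact: nbhs_infty_gt.
Unshelve. all: by end_near.
Qed.

End Regimes.

Theorem theorem1p4 (R : realType) (p : nat -> R)
    (p01 : forall n, 0 <= p n <= 1) (x : R) (hd : degree_exponent p x) :
  [/\ 0 < x <= 1 / 8 ->
        exists2 y4 : R, unique_solution x 4 y4 &
        exists2 g : nat -> R, O_inv_log g &
          whp p (fun n G => (ms_dim R G <= (n%:R `^ (y4 + g n))%:E)%E),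
      0 < x <= 1 / 2 ->
        exists2 y1 : R, unique_solution x 1 y1 &
        exists2 h : nat -> R, O_inv_log h &
          whp p (fun n G => ((n%:R `^ (y1 + h n))%:E <= ms_dim R G)%E) &
      1 / 2 < x < 1 ->
        whp p (fun n G => ms_dim R G == +oo%E)].
Proof.
split.
- move=> x8; have [y uy] := @unique_solution_nat R x 7 4 x8 isT isT.
  exists y => //; have [[y01 fy] _] := uy; apply: (whp_ms_dim_le p01 hd) => //.
  by case/andP: x8 => ? ?; apply/andP; split; lra.
- move=> x2; have [y uy] := @unique_solution_nat R x 1 1 x2 isT isT.
  exists y => //; have [[y01 fy] _] := uy; apply: (whp_ms_dim_ge p01 hd) => //.
  by case/andP: x2 => ? ?; apply/andP; split; lra.
- exact: whp_ms_dim_pinfty.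
Qed.
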